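(* For every $p\in(0,1)$, the limit $\alpha=\alpha(p)\in(1/2,1)$ in probability of $\log\mathrm{LIS}(T_n)/\log n$ is the unique solution in $(1/2,1)$ of $$\frac{1}{4^{\frac{1}{2\alpha}}\sqrt{\pi}}\,\frac{\Gamma\big(\tfrac12-\tfrac1{2\alpha}\big)}{\Gamma\big(1-\tfrac1{2\alpha}\big)}=\frac{p}{p-1}.$$
   Context: A sign-decorated binary tree is a finite planar rooted tree in which every internal vertex (node) has exactly two ordered children and carries a sign $\oplus$ or $\ominus$. A subtree induced by a set of leaves $\mathcal L$ is obtained by deleting vertices with no descendant in $\mathcal L$ and contracting vertices with one child; it is positive if all its nodes carry $\oplus$. $\mathrm{LIS}(t)$ is the maximal number of leaves of a positive subtree of $t$. Fix $p\in(0,1)$. $T_n$ is a uniform planar rooted binary tree with $n$ leaves with i.i.d. node signs, $\mathbb P(\oplus)=p$. It is known (from the previous result) that $\log\mathrm{LIS}(T_n)/\log n$ converges in probability to some $\alpha\in(1/2,1)$. *)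

(* Defs.v *)
From HB Require Import structures.
From mathcomp Require Import all_boot all_order all_algebra.
From mathcomp Require Import all_classical all_reals all_analysis.
Set Implicit Arguments. Unset Strict Implicit. Unset Printing Implicit Defensive.
Import Order.TTheory GRing.Theory Num.Theory.
Local Open Scope ring_scope.
Local Open Scope classical_set_scope.

(* Sign-decorated planar rooted binary trees: every internal node has two
   ordered children and a sign; [true] = (+), [false] = (-). *)
Inductive stree : Type :=
| SLeaf : stree
| SNode : bool -> stree -> stree -> stree.

Fixpoint nleaves (t : stree) : nat :=
  match t with SLeaf => 1%N | SNode _ l r => (nleaves l + nleaves r)%N end.

Fixpoint nplus (t : stree) : nat :=
  match t with SLeaf => 0%N | SNode s l r => (s + nplus l + nplus r)%N end.

Fixpoint nminus (t : stree) : nat :=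
  match t with SLeaf => 0%N | SNode s l r => (~~ s + nminus l + nminus r)%N end.

Fixpoint positive (t : stree) : bool :=
  match t with SLeaf => true | SNode s l r => [&& s, positive l & positive r] end.

(* Subtree induced by a set of leaves, the set being given as a mask over the
   leaves in left-to-right order.  Vertices with no descendant in the set are
   deleted, and vertices left with one child are contracted.  Returns the
   induced subtree (None if the set is empty) and the unused part of the mask. *)
Fixpoint induced (t : stree) (m : seq bool) : option stree * seq bool :=
  match t with
  | SLeaf => match m with
             | b :: m' => (if b then Some SLeaf else None, m')
             | [::] => (None, [::])
             end
  | SNode s l r =>
      let (ol, m1) := induced l m in
      let (or, m2) := induced r m1 in
      (match ol, or with
       | Some a, Some b => Some (SNode s a b)
       | Some a, None => Some a
       | None, Some b => Some b
       | None, None => None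
       end, m2)
  end.

Definition induced_positive (t : stree) (m : seq bool) : bool :=
  match (induced t m).1 with Some u => positive u | None => true end.

Definition LIS (t : stree) : nat :=
  \max_(m : (nleaves t).-tuple bool | induced_positive t m) count id m.

(* Enumeration of all sign-decorated binary trees with n leaves
   (fuel argument; fuel n suffices). *)
Fixpoint trees_fuel (fuel n : nat) : seq stree :=
  match fuel with
  | 0%N => [::]
  | fuel'.+1 =>
      if n == 1%N then [:: SLeaf]
      else flatten [seq flatten [seq [seq SNode s lr.1 lr.2 | s <- [:: true; false]]
                                 | lr <- [seq (l, r) | l <- trees_fuel fuel' i,
                                                       r <- trees_fuel fuel' (n - i)]]
                   | i <- iota 1 n.-1]
  end.

Definition all_trees (n : nat) : seq stree := trees_fuel n n.

(* Law of T_n: uniform shape with n leaves, i.i.d. signs with P(+) = p.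
   A decorated tree t gets weight p^#(+) (1-p)^#(-); normalizing by the total
   weight (= number of shapes) gives exactly the law of T_n. *)
Definition weight {R : realType} (p : R) (t : stree) : R :=
  p ^+ nplus t * (1 - p) ^+ nminus t.

Definition Prob_T {R : realType} (p : R) (n : nat) (E : pred stree) : R :=
  (\sum_(t <- all_trees n | E t) weight p t) / (\sum_(t <- all_trees n) weight p t).

(* Euler Gamma function: integral for x > 0, extended to non-positive
   non-integers by the functional equation Gamma(x) = Gamma(x+N)/(x(x+1)...(x+N-1)). *)
Definition Gamma_pos {R : realType} (x : R) : R :=
  Rintegral lebesgue_measure `]0, +oo[ (fun t : R => t `^ (x - 1) * expR (- t)).

Definition Gamma {R : realType} (x : R) : R :=
  if 0 < x then Gamma_pos x
  else let N := (Num.truncn (- x)).+1 in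
       Gamma_pos (x + N%:R) / \prod_(k < N) (x + k%:R).

(* Main.v *)
Require Import Defs.
From HB Require Import structures.
From mathcomp Require Import all_boot all_order all_algebra.
From mathcomp Require Import all_classical all_reals all_analysis.
From mathcomp Require Import measurable_realfun ring lra zify.
Set Implicit Arguments. Unset Strict Implicit. Unset Printing Implicit Defensive.
Import Order.TTheory GRing.Theory Num.Theory.
Import numFieldNormedType.Exports.
Local Open Scope ring_scope.
Local Open Scope classical_set_scope.

(** [LIS] satisfies a recursion: it is additive at positive nodes and is the
    maximum of the two sides at negative ones.  Hence the law of [LIS] for a
    critical binary Galton-Watson tree is a fixed point of a monotone operator,
    and the same holds after weighting a tree with [n] leaves by [z ^+ n].

    Write [b = 1 / (2 * alpha)] and let [A a k] be the coefficient of [s ^ k] in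
    [(1 - s) `^ (a - 1)].  If [Y1, Y2] are independent with tail
    [P(Y > k) = A b k], then [P(Y1 + Y2 > k) - 2 P(Y > k) = - A (2 * b) k]
    exactly.  So [A b] is a sub- or a supersolution of the fixed point equation
    according to the position of the ratio [r b k = - A (2 * b) k / A b k ^+ 2]
    with respect to [(1 - p) / p].  This ratio is nonincreasing in [k] and
    increasing in [b]; by the Gauss asymptotics of Gamma, its limit in [k] is
    minus the inverse of the left-hand side of the equation for [alpha].

    Lower bound: for [b] above the critical value, [1 - A b k] dominates, for
    [k <= x], the generating function of [P(LIS(T_n) <= k)] at a point
    [z = 1 + c * A b x ^+ 2 > 1], so that [P(LIS(T_n) <= x)] decays like
    [z ^- n], up to a polynomial factor.

    Upper bound: for [b] below the critical value, a multiple of [A b k] bounds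
    the tail of [LIS] for the Galton-Watson tree, and the law of [LIS(T_n)] is
    stochastically nondecreasing in [n] by Remy's leaf insertion. *)

(** * The recursive structure of LIS *)

Fixpoint lis (t : stree) : nat :=
  match t with
  | SLeaf => 1%N
  | SNode s l r => if s then (lis l + lis r)%N else maxn (lis l) (lis r)
  end.

Lemma lis_gt0 t : (0 < lis t)%N.
Proof. by elim: t => [|[] l IHl r IHr] //=; rewrite ?addn_gt0 ?leq_max IHl. Qed.

Lemma mask_split (m : seq bool) a b : size m = (a + b)%N ->
  exists m1 m2, [/\ m = m1 ++ m2, size m1 = a & size m2 = b].
Proof.
move=> hm; exists (take a m), (drop a m).
by rewrite cat_take_drop size_takel ?hm ?leq_addr// size_drop hm addKn.
Qed.

Lemma induced_cat t m m' : size m = nleaves t ->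
  Defs.induced t (m ++ m') = ((Defs.induced t m).1, m').
Proof.
elim: t m m' => [|s l IHl r IHr] m m' /=; first by case: m => [|b []].
move=> /mask_split[m1 [m2 [-> h1 h2]]].
by rewrite -catA !IHl// -{2}(cats0 m2) !IHr.
Qed.

Lemma induced_node s l r m1 m2 : size m1 = nleaves l -> size m2 = nleaves r ->
  (Defs.induced (SNode s l r) (m1 ++ m2)).1 =
  match (Defs.induced l m1).1, (Defs.induced r m2).1 with
  | Some a, Some b => Some (SNode s a b)
  | Some a, None => Some a
  | None, Some b => Some b
  | None, None => None
  end.
Proof. by move=> h1 h2 /=; rewrite induced_cat// -{1}(cats0 m2) induced_cat. Qed.

Lemma induced_None t m : size m = nleaves t -> (Defs.induced t m).1 = None ->
  count id m = 0%N.
Proof.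
elim: t m => [|s l IHl r IHr] m; first by case: m => [|[] []].
move=> /mask_split[m1 [m2 [-> h1 h2]]]; rewrite induced_node// count_cat.
case E1: (Defs.induced l m1).1 => [a|]; case E2: (Defs.induced r m2).1 => [b|] // _.
by rewrite (IHl _ h1 E1) (IHr _ h2 E2).
Qed.

Lemma induced_nseq t : (Defs.induced t (nseq (nleaves t) false)).1 = None.
Proof.
elim: t => [|s l IHl r IHr] //; rewrite /nleaves -/nleaves nseqD.
by rewrite induced_node ?size_nseq// IHl IHr.
Qed.

(** A mask that keeps leaves on both sides of a node keeps the node with its sign. At a negative
    node a positive induced subtree therefore lives on one side, whence the maximum. *)
Lemma count_le_lis t m : size m = nleaves t -> induced_positive t m ->
  (count id m <= lis t)%N.
Proof.
rewrite /induced_positive.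
elim: t m => [|s l IHl r IHr] m; first by case: m => [|[] []].
move=> /mask_split[m1 [m2 [-> h1 h2]]]; rewrite induced_node// count_cat /=.
have := IHl _ h1; have := IHr _ h2.
case E1: (Defs.induced l m1).1 => [a|]; case E2: (Defs.induced r m2).1 => [b|] /=.
- move=> Hr Hl /and3P[-> /Hl Hl' /Hr Hr']; exact: leq_add.
- move=> _ Hl /Hl; rewrite (induced_None h2 E2) addn0 => /leq_trans; apply.
  by case: s; rewrite ?leq_addr ?leq_maxl.
- move=> Hr _ /Hr; rewrite (induced_None h1 E1) add0n => /leq_trans; apply.
  by case: s; rewrite ?leq_addl ?leq_maxr.
- by rewrite (induced_None h1 E1) (induced_None h2 E2).
Qed.

Lemma lis_attained t :
  exists m, [/\ size m = nleaves t, induced_positive t m & count id m = lis t].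
Proof.
rewrite /induced_positive.
elim: t => [|s l [ml [sl pl cl]] r [mr [sr pr cr]]]; first by exists [:: true].
case: s => /=.
  exists (ml ++ mr); rewrite size_cat sl sr induced_node// count_cat cl cr.
  split=> //; move: pl pr.
  by case: (Defs.induced l ml).1 => [a|]; case: (Defs.induced r mr).1 => [b|] //= -> ->.
(* At a negative node the weaker side is masked out entirely. *)
case: (leqP (lis r) (lis l)) => _.
- exists (ml ++ nseq (nleaves r) false).
  rewrite size_cat size_nseq sl induced_node ?size_nseq// count_cat cl.
  rewrite induced_nseq count_nseq /= mul0n addn0; split=> //.
  by move: pl; case: (Defs.induced l ml).1.
- exists (nseq (nleaves l) false ++ mr).
  rewrite size_cat size_nseq sr induced_node ?size_nseq// count_cat cr.
  by rewrite induced_nseq count_nseq; split=> //; move: pr; case: (Defs.induced r mr).1.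
Qed.

Lemma LIS_lis t : LIS t = lis t.
Proof.
apply/eqP; rewrite eqn_leq; apply/andP; split.
  by apply/bigmax_leqP => m; apply: count_le_lis; rewrite size_tuple.
have [m [/eqP sm pm <-]] := lis_attained t.
exact: (leq_bigmax_cond (Tuple sm)).
Qed.

Lemma trees_fuel_irr f1 f2 n : (n <= f1)%N -> (n <= f2)%N ->
  trees_fuel f1 n = trees_fuel f2 n.
Proof.
elim: f1 f2 n => [|f1 IH] [|f2] n //=; rewrite ?leqn0.
- by move=> /eqP ->.
- by move=> _ /eqP ->.
move=> h1 h2; case: eqP => // _; congr flatten; apply/eq_in_map => i.
rewrite mem_iota => hi.
by rewrite (IH f2 i) ?(IH f2 (n - i)%N)//; lia.
Qed.

Lemma sum_all_trees (R : realType) (F : stree -> R) n :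
  \sum_(t <- all_trees n.+2) F t =
  \sum_(i < n.+1) \sum_(l <- all_trees i.+1) \sum_(r <- all_trees (n - i).+1)
     (F (SNode true l r) + F (SNode false l r)).
Proof.
have -> : all_trees n.+2 = flatten
    [seq flatten [seq [seq SNode s lr.1 lr.2 | s <- [:: true; false]]
      | lr <- [seq (l, r) | l <- trees_fuel n.+1 i, r <- trees_fuel n.+1 (n.+2 - i)]]
    | i <- iota 1 n.+1] by [].
rewrite big_flatten big_map.
rewrite -[iota 1 n.+1]/(index_iota 1 n.+2) big_add1 big_mkord.
apply: eq_bigr => i _; rewrite big_flatten big_map big_allpairs_dep.
rewrite (@trees_fuel_irr _ i.+1)//.
apply: eq_bigr => l _.
have hi : (i <= n)%N by rewrite -ltnS.
have -> : (n.+2 - i.+1 = (n - i).+1)%N by rewrite subSS subSn.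
rewrite (@trees_fuel_irr _ (n - i).+1)//; last by lia.
by apply: eq_bigr => r _; rewrite !big_cons big_nil /= addr0.
Qed.

(** * Weighted sums over trees, the Catalan recursion and monotonicity in the size *)

Section TreeFunctional.
Context {R : realType} (p : R) (hp0 : 0 < p) (hp1 : p < 1).

(* The index is shifted by one: [lsum n] concerns the trees with [n.+1] leaves. *)
Definition lsum (n : nat) (phi : nat -> R) : R :=
  \sum_(t <- all_trees n.+1) weight p t * phi (lis t).

(** The mean of [phi] at the root over its random sign, when the two subtrees have [lis] equal to
    [a] and [b]. *)
Definition join (phi : nat -> R) (a b : nat) : R :=
  p * phi (a + b)%N + (1 - p) * phi (maxn a b).

Lemma weight_ge0 t : 0 <= weight p t.
Proof. by move: hp0 hp1 => q0 q1; apply: mulr_ge0; apply: exprn_ge0; lra. Qed.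

Lemma weight_node s l r :
  weight p (SNode s l r) = (if s then p else 1 - p) * weight p l * weight p r.
Proof. by rewrite /weight /=; case: s; rewrite /= ?exprD ?exprS ?expr0; ring. Qed.

Lemma lsum0 phi : lsum 0 phi = phi 1%N.
Proof. by rewrite /lsum /= big_seq1 /weight /= !expr0 !mul1r. Qed.

Lemma lsumS n phi :
  lsum n.+1 phi =
  \sum_(i < n.+1) lsum i (fun a => lsum (n - i) (fun b => join phi a b)).
Proof.
rewrite /lsum sum_all_trees; apply: eq_bigr => i _; apply: eq_bigr => l _.
rewrite mulr_sumr; apply: eq_bigr => r _.
by rewrite !weight_node /= /join; ring.
Qed.

Lemma lsum_le n phi psi : (forall a, (0 < a)%N -> phi a <= psi a) ->
  lsum n phi <= lsum n psi.
Proof.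
move=> h; apply: ler_sum => t _; apply: ler_wpM2l; first exact: weight_ge0.
exact/h/lis_gt0.
Qed.

Lemma lsum_ext n phi psi : phi =1 psi -> lsum n phi = lsum n psi.
Proof. by move=> h; apply: eq_bigr => t _; rewrite h. Qed.

Lemma lsumZD n c phi psi :
  lsum n (fun a => c * phi a + psi a) = c * lsum n phi + lsum n psi.
Proof.
rewrite /lsum mulr_sumr -big_split /=; apply: eq_bigr => t _; ring.
Qed.

Lemma lsumZ n c phi : lsum n (fun a => c * phi a) = c * lsum n phi.
Proof. by rewrite /lsum mulr_sumr; apply: eq_bigr => t _; ring. Qed.

Lemma join_le phi a a' b b' : {homo phi : x y / (x <= y)%N >-> x <= y} ->
  (a <= a')%N -> (b <= b')%N -> join phi a b <= join phi a' b'.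
Proof.
move: hp0 hp1 => q0 q1 h ha hb; apply: lerD; apply: ler_wpM2l; try lra.
  by apply: h; lia.
by apply: h; lia.
Qed.

Lemma join_ge (phi : nat -> R) a b : {homo phi : x y / (x <= y)%N >-> x <= y} ->
  phi b <= join phi a b.
Proof.
move: hp0 hp1 => q0 q1 h; have h1 : phi b <= phi (a + b)%N by apply: h; lia.
have h2 : phi b <= phi (maxn a b) by apply: h; lia.
rewrite /join; have := ler_wpM2l (ltW q0) h1.
have := @ler_wpM2l _ (1 - p) _ _ _ h2; lra.
Qed.

Lemma joinC phi a b : join phi a b = join phi b a.
Proof. by rewrite /join addnC maxnC. Qed.

(* Remy's leaf insertion, read as a stochastic domination: growing the left or
   the right subtree accounts for [2 * (2 * n)] of the insertions, and grafting
   at the root for the two remaining ones. *)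
Lemma lsum_mono n phi : {homo phi : x y / (x <= y)%N >-> x <= y} ->
  (2 * (2 * n + 1))%:R * lsum n phi <= n.+2%:R * lsum n.+1 phi.
Proof.
elim/ltn_ind: n phi => n IH phi hphi.
pose T i j := lsum i (fun a => lsum j (fun b => join phi a b)).
have hA (i j : nat) : (i < n)%N ->
    (2 * (2 * i + 1))%:R * T i j <= i.+2%:R * T i.+1 j.
  move=> hi; apply: IH => // x y hxy; apply: lsum_le => b _.
  exact: join_le.
have hB (i j : nat) : (j < n)%N ->
    (2 * (2 * j + 1))%:R * T i j <= j.+2%:R * T i j.+1.
  move=> hj; rewrite /T -!lsumZ; apply: lsum_le => a _.
  by apply: IH => // x y hxy; apply: join_le.
have h0 : lsum n phi <= T 0%N n.
  by rewrite /T lsum0; apply: lsum_le => b _; apply: join_ge.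
have hn : lsum n phi <= T n 0%N.
  by apply: lsum_le => a _; rewrite lsum0 joinC; apply: join_ge.
have -> : n.+2%:R * lsum n.+1 phi =
    \sum_(i < n.+1) i.+1%:R * T i (n - i)%N
    + \sum_(i < n.+1) (n - i).+1%:R * T i (n - i)%N.
  rewrite lsumS mulr_sumr -big_split /=; apply: eq_bigr => i _.
  rewrite -mulrDl -natrD; congr (_%:R * _); have := ltn_ord i; lia.
(* The terms [T 0 n] and [T n 0] split off here are the two graftings at the root. *)
rewrite big_ord_recl [X in _ + X]big_ord_recr /= subn0 subnn !mul1r.
(* For [i + j = n - 1] the weights [2 * (2 * i + 1)] and [2 * (2 * j + 1)] add up to [4 * n],
   whatever the root splitting. *)
have -> : (2 * (2 * n + 1))%:R * lsum n phi = lsum n phi + lsum n phi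
    + (\sum_(i < n) (2 * (2 * i + 1))%:R * T i (n.-1 - i)%N
       + \sum_(i < n) (2 * (2 * (n.-1 - i) + 1))%:R * T i (n.-1 - i)%N).
  case: n {IH hA hB h0 hn} @T => [|n] T; first by rewrite !big_ord0; ring.
  have -> : \sum_(i < n.+1) (2 * (2 * i + 1))%:R * T i (n - i)%N
       + \sum_(i < n.+1) (2 * (2 * (n - i) + 1))%:R * T i (n - i)%N =
       (4 * n.+1)%:R * lsum n.+1 phi.
    rewrite lsumS mulr_sumr -big_split /=; apply: eq_bigr => i _.
    rewrite -[RHS]/(_ * T i (n - i)%N) -mulrDl -natrD; congr (_%:R * _).
    have := ltn_ord i; lia.
  by rewrite !natrM natrD natrM; ring.
have hA' : \sum_(i < n) (2 * (2 * i + 1))%:R * T i (n.-1 - i)%N <=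
    \sum_(i < n) (bump 0 i).+1%:R * T (bump 0 i) (n - bump 0 i)%N.
  apply: ler_sum => i _; have hi := ltn_ord i; rewrite /bump /= add1n.
  have -> : (n - i.+1 = n.-1 - i)%N by lia.
  exact: hA.
have hB' : \sum_(i < n) (2 * (2 * (n.-1 - i) + 1))%:R * T i (n.-1 - i)%N <=
    \sum_(i < n) (n - i).+1%:R * T i (n - i)%N.
  apply: ler_sum => i _; have hi := ltn_ord i.
  have -> : (n - i = (n.-1 - i).+1)%N by lia.
  by apply: hB; lia.
lra.
Qed.

Definition ntrees (n : nat) : R := lsum n (fun=> 1).

(** The Catalan recursion: the constants [1] and [-1] are both nondecreasing, so [lsum_mono] gives
    the two inequalities. *)
Lemma ntreesS n : n.+2%:R * ntrees n.+1 = (2 * (2 * n + 1))%:R * ntrees n.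
Proof.
apply/eqP; rewrite eq_le; apply/andP; split; last by apply: lsum_mono.
have := @lsum_mono n (fun=> -1) (fun _ _ _ => lexx _).
have h m : lsum m (fun=> -1) = - ntrees m.
  rewrite /ntrees -[RHS]mulN1r -lsumZ; apply: lsum_ext => a; ring.
by rewrite !h !mulrN lerN2.
Qed.

Lemma ntrees_gt0 n : 0 < ntrees n.
Proof.
elim: n => [|n IH]; first by rewrite /ntrees lsum0.
by rewrite -(@pmulr_rgt0 _ n.+2%:R)// ntreesS mulr_gt0// ltr0n; lia.
Qed.

Lemma lsum_ratio_mono phi m n : {homo phi : x y / (x <= y)%N >-> x <= y} ->
  (m <= n)%N -> lsum m phi / ntrees m <= lsum n phi / ntrees n.
Proof.
move=> hphi /subnK <-; elim: (n - m)%N => [|k IH] //; rewrite addSn.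
apply: (le_trans IH); set j := (k + m)%N.
rewrite ler_pdivrMr ?ntrees_gt0// mulrAC ler_pdivlMr ?ntrees_gt0//.
rewrite -(@ler_pM2l _ j.+2%:R)//.
rewrite mulrCA ntreesS [leLHS]mulrCA mulrA [leRHS]mulrA.
apply: ler_wpM2r; first exact: ltW (ntrees_gt0 _).
exact: lsum_mono.
Qed.

(* The probability that a critical binary Galton-Watson tree has [n.+1] leaves. *)
Definition gw (n : nat) : R := ntrees n / (2 * 4 ^+ n).

Lemma gw0 : gw 0 = 1 / 2.
Proof. by rewrite /gw /ntrees lsum0 expr0 mulr1. Qed.

Lemma gwS n : (2 * n%:R + 4) * gw n.+1 = (2 * n%:R + 1) * gw n.
Proof.
have := ntreesS n; rewrite /gw exprS natrM natrD natrM -addn2 natrD => h.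
have h4 : 4 ^+ n != 0 :> R by rewrite expf_neq0.
have -> : ntrees n.+1 = 2%:R * (2%:R * n%:R + 1%:R) * ntrees n / (n%:R + 2%:R).
  rewrite -h; field; have : 0 <= n%:R :> R by []; lra.
have : 0 <= n%:R :> R by [].
move=> ?; field; rewrite h4/=; lra.
Qed.

Lemma gw_ge0 n : 0 <= gw n.
Proof. by rewrite divr_ge0 ?mulr_ge0 ?exprn_ge0// ltW// ntrees_gt0. Qed.

(** [gw n] has order [n ^ (- 3 / 2)]. By [gwS] the right-hand side is nondecreasing in [n], and it
    equals [1 / 32] at [n = 0]. *)
Lemma gw_lower n : 1 / 32 <= gw n ^+ 2 * (n%:R + 1 / 2) ^+ 3.
Proof.
elim: n => [|n IH]; first by rewrite gw0; lra.
apply: (le_trans IH).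
have hn : 0 <= n%:R :> R by [].
have -> : gw n.+1 = (2 * n%:R + 1) * gw n / (2 * n%:R + 4).
  by rewrite -gwS; field; lra.
rewrite -(natr1 n); set x := n%:R; set g := gw n.
have -> : ((2 * x + 1) * g / (2 * x + 4)) ^+ 2 * (x + 1 + 1 / 2) ^+ 3 =
    g ^+ 2 * (((2 * x + 1) ^+ 2 * (x + 3 / 2) ^+ 3) / (2 * x + 4) ^+ 2).
  by field; rewrite /x; lra.
apply: ler_wpM2l; first exact: sqr_ge0.
rewrite ler_pdivlMr; last by apply: exprn_gt0; rewrite /x; lra.
rewrite -subr_ge0.
have -> : (2 * x + 1) ^+ 2 * (x + 3 / 2) ^+ 3 - (x + 1 / 2) ^+ 3 * (2 * x + 4) ^+ 2
    = (2 * x + 1) ^+ 2 * (3 / 4 * x + 11 / 8) by field.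
by apply: mulr_ge0; [exact: sqr_ge0|rewrite /x; lra].
Qed.

End TreeFunctional.

(** * The coefficients of a power of 1 - s *)

Section Sibuya.
Context {R : realType}.
Implicit Types (a b : R) (k n : nat).

(* The coefficient of [s ^ k] in [(1 - s) `^ (a - 1)]; for [0 < a < 1] this is
   the tail [P(Y > k)] of the law with generating function [1 - (1 - s) `^ a]. *)
Definition sib a k : R := \prod_(j < k) (1 - a / j.+1%:R).

Lemma sib0 a : sib a 0 = 1.
Proof. by rewrite /sib big_ord0. Qed.

Lemma sibS a k : sib a k.+1 = sib a k * (1 - a / k.+1%:R).
Proof. by rewrite /sib big_ord_recr. Qed.

Lemma sibM a k : k.+1%:R * sib a k.+1 = (k.+1%:R - a) * sib a k.
Proof. by rewrite sibS; field. Qed.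

(** Multiplication of the power series [(1 - s) ^ (a - 1)] and [(1 - s) ^ (b - 1)]. *)
Lemma sib_conv a b k :
  \sum_(i < k.+1) sib a i * sib b (k - i) = sib (a + b - 1) k.
Proof.
elim: k => [|k IH]; first by rewrite big_ord1 !sib0 mulr1.
apply: (@mulfI _ k.+1%:R); first by rewrite pnatr_eq0.
rewrite sibM -IH.
(* Writing [k + 1 = i + (k + 1 - i)] is the product rule for the derivative of the product
   series. *)
have -> : k.+1%:R * (\sum_(i < k.+2) sib a i * sib b (k.+1 - i)) =
    \sum_(i < k.+2) (i%:R * sib a i) * sib b (k.+1 - i)
    + \sum_(i < k.+2) sib a i * ((k.+1 - i)%:R * sib b (k.+1 - i)).
  rewrite mulr_sumr -big_split /=; apply: eq_bigr => i _.
  by rewrite natrB -1?ltnS//; ring.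
rewrite big_ord_recl [X in _ + X]big_ord_recr /= subnn !mul0r mulr0 add0r addr0.
rewrite mulr_sumr -big_split /=; apply: eq_bigr => i _.
have hi : (i <= k)%N by rewrite -ltnS.
rewrite /bump /= add1n subSS (subSn hi) !sibM -!natr1 natrB//; ring.
Qed.

Lemma sib_ext0 k : sib 0 k = 1.
Proof. by rewrite /sib big1// => i _; rewrite mul0r subr0. Qed.

Lemma sib_sum a k : \sum_(i < k.+1) sib (a + 1) i = sib a k.
Proof.
have := sib_conv (a + 1) 0 k; rewrite addr0 addrK => <-.
by apply: eq_bigr => i _; rewrite sib_ext0 mulr1.
Qed.

(** For [0 < a < 1], minus the left-hand side is thus the mass at [k + 1] of the law with tail
    [sib a]. *)
Lemma sib_shift a k : sib (a + 1) k.+1 = sib a k.+1 - sib a k.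
Proof. by rewrite -(sib_sum a k.+1) big_ord_recr /= sib_sum; ring. Qed.

Lemma sib_diff a k : sib a k - sib a k.+1 = a / k.+1%:R * sib a k.
Proof. by rewrite sibS; ring. Qed.

Lemma sib_gt0 a k : a < 1 -> 0 < sib a k.
Proof.
move=> ha; apply: prodr_gt0 => j _; rewrite subr_gt0 ltr_pdivrMr// mul1r.
by apply: (lt_le_trans ha); rewrite ler1n.
Qed.

Lemma sib_noninc a k : 0 <= a < 1 -> sib a k.+1 <= sib a k.
Proof.
move=> /andP[a0 a1]; rewrite -subr_ge0 sib_diff mulr_ge0 ?divr_ge0//.
exact/ltW/sib_gt0.
Qed.

Lemma sib_noninc_le a j k : 0 <= a < 1 -> (j <= k)%N -> sib a k <= sib a j.
Proof.
move=> ha /subnK <-; elim: (k - j)%N => [|m IH] //; rewrite addSn.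
exact: le_trans (sib_noninc _ ha) IH.
Qed.

Lemma sib_le1 a k : 0 <= a < 1 -> sib a k <= 1.
Proof. by move=> ha; rewrite -(sib0 a) sib_noninc_le. Qed.

(* The distribution function of a sum of two independent variables with
   distribution function [N], when [N 0 = 0]. *)
Definition cdf2 (N : nat -> R) k : R :=
  \sum_(i < k) (N i.+1 - N i) * N (k - i.+1)%N.

(** For independent [Y1], [Y2] with tail [G] and positive integer values, this is the probability
    that both are at most [k] while their sum exceeds [k]. *)
Definition excess (G : nat -> R) k : R :=
  \sum_(i < k) (G i - G i.+1) * (G (k - i.+1)%N - G k).

Lemma sum_diff_ord (G : nat -> R) k :
  \sum_(i < k) (G i - G i.+1) = G 0%N - G k.
Proof.
elim: k => [|k IH]; first by rewrite big_ord0 subrr.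
by rewrite big_ord_recr /= IH; ring.
Qed.

Lemma cdf2_excess (G : nat -> R) k : G 0%N = 1 ->
  cdf2 (fun i => 1 - G i) k = (1 - G k) ^+ 2 - excess G k.
Proof.
move=> G0; rewrite /cdf2 /excess.
have tel : \sum_(i < k) (G i - G i.+1) = 1 - G k.
  by rewrite sum_diff_ord G0.
rewrite expr2 -[X in X * _ - _]tel mulr_suml -sumrB; apply: eq_bigr => i _; ring.
Qed.

(** In the convolution of [sib (b + 1)] with [sib b], which is [sib (2 * b)], the term of index 0 is
    [sib b k]; by [sib_shift] the other terms are minus masses times tails. *)
Lemma excess_sib b k : excess (sib b) k = sib b k ^+ 2 - sib (2 * b) k.
Proof.
have := sib_conv (b + 1) b k.
rewrite (_ : b + 1 + b - 1 = 2 * b); last by ring.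
rewrite big_ord_recl sib0 mul1r subn0 => <-.
have tel : \sum_(i < k) (sib b i - sib b i.+1) = 1 - sib b k.
  by rewrite sum_diff_ord sib0.
have -> : \sum_(i < k) sib (b + 1) (lift ord0 i) * sib b (k - lift ord0 i) =
    - \sum_(i < k) (sib b i - sib b i.+1) * sib b (k - i.+1)%N.
  rewrite -sumrN; apply: eq_bigr => i _.
  by rewrite /= /bump /= add1n sib_shift; ring.
rewrite /excess (eq_bigr (fun i : 'I_k => (sib b i - sib b i.+1) * sib b (k - i.+1)%N
  - (sib b i - sib b i.+1) * sib b k)); last by move=> i _; ring.
rewrite sumrB -mulr_suml tel; ring.
Qed.

Definition sib_ratio b k : R := - sib (2 * b) k / sib b k ^+ 2.

(** The first factor [1 - 2 * b] is nonpositive and all later ones are positive. *)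
Lemma sib2_le0 b k : 1 / 2 <= b < 1 -> sib (2 * b) k.+1 <= 0.
Proof.
move=> /andP[b0 b1]; elim: k => [|k IH].
  by rewrite sibS sib0; lra.
rewrite sibS mulr_le0_ge0// subr_ge0 ler_pdivrMr// mul1r.
by rewrite (@le_trans _ _ 2%:R)//; [lra|rewrite ler_nat].
Qed.

Lemma ratio_ge0 b k : 1 / 2 <= b < 1 -> 0 <= sib_ratio b k.+1.
Proof.
by move=> hb; rewrite /sib_ratio divr_ge0 ?sqr_ge0// oppr_ge0 sib2_le0.
Qed.

Lemma ratioE b k : b < 1 -> - sib (2 * b) k = sib_ratio b k * sib b k ^+ 2.
Proof.
by move=> hb; rewrite /sib_ratio divfK// expf_neq0// gt_eqF// sib_gt0.
Qed.

(** One step multiplies the ratio by [(1 - 2 * t) / (1 - t) ^+ 2] with [t = b / (k + 2)], and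
    [1 - 2 * t <= (1 - t) ^+ 2]. *)
Lemma ratio_noninc b k : 1 / 2 <= b < 1 -> sib_ratio b k.+2 <= sib_ratio b k.+1.
Proof.
move=> /[dup] hb /andP[b0 b1].
have g k' := sib_gt0 k' b1.
rewrite /sib_ratio ler_pdivrMr ?exprn_gt0// mulrAC ler_pdivlMr ?exprn_gt0//.
rewrite (sibS (2 * b) k.+1) (sibS b k.+1) exprMn.
set t := b / _; have -> : 2 * b / k.+2%:R = 2 * t by rewrite mulrA.
have h : 0 <= - sib (2 * b) k.+1 * sib b k.+1 ^+ 2.
  by rewrite mulr_ge0 ?sqr_ge0// oppr_ge0 sib2_le0.
have := sqr_ge0 t; nra.
Qed.

Lemma sib_ratio_mono b b' j k : b <= b' -> b' < 1 -> (j <= k)%N ->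
  sib b j / sib b k <= sib b' j / sib b' k.
Proof.
move=> bb b1 /subnK <-.
have b1' : b < 1 by apply: le_lt_trans b1.
have g k' := sib_gt0 k' b1; have g' k' := sib_gt0 k' b1'.
elim: (k - j)%N => [|m IH]; first by rewrite !divff// gt_eqF.
have h : b / (m + j).+1%:R <= b' / (m + j).+1%:R by rewrite ler_pM2r ?invr_gt0.
have h1 : b' / (m + j).+1%:R < 1.
  by rewrite ltr_pdivrMr// mul1r (lt_le_trans b1)// ler1n.
rewrite addSn !sibS; move: h h1; move: (b / _) (b' / _) => s t h h1.
rewrite !invfM !mulrA ler_pM//.
- by rewrite divr_ge0 ?ltW.
- by rewrite invr_ge0; lra.
- by rewrite lef_pV2 ?posrE; lra.
Qed.

(** [(sib_ratio b k + 1) / b] is a sum of products of factors nondecreasing in [b], by expanding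
    [excess]. Keeping the division by [b] is what later gives strict monotonicity. *)
Lemma ratio_mono b b' k : 0 < b -> b <= b' -> b' < 1 ->
  (sib_ratio b k + 1) * b' <= (sib_ratio b' k + 1) * b.
Proof.
move=> b0 bb b1; have b1' : b < 1 by apply: le_lt_trans b1.
have b0' : 0 < b' by apply: lt_le_trans bb.
have E c : 0 < c -> c < 1 -> sib_ratio c k + 1 = c * \sum_(i < k)
    i.+1%:R^-1 * (sib c i / sib c k) * (sib c (k - i.+1)%N / sib c k - 1).
  move=> c0 c1; have g := sib_gt0 k c1.
  have -> : sib_ratio c k + 1 = excess (sib c) k / sib c k ^+ 2.
    by rewrite excess_sib /sib_ratio; field; rewrite gt_eqF.
  rewrite /excess mulr_suml mulr_sumr; apply: eq_bigr => i _.
  by rewrite sib_diff; field; rewrite gt_eqF//= addrC natr1.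
rewrite !E// [leLHS]mulrAC [leRHS]mulrAC [b' * b]mulrC ler_pM2l ?mulr_gt0//.
apply: ler_sum => i _.
have hi : (k - i.+1 <= k)%N by rewrite leq_subr.
apply: ler_pM.
- by rewrite mulr_ge0 ?invr_ge0// divr_ge0// ltW// sib_gt0.
- rewrite subr_ge0 ler_pdivlMr ?sib_gt0// mul1r sib_noninc_le//; lra.
- by rewrite ler_pM2l ?invr_gt0// sib_ratio_mono// ltnW.
- by rewrite lerB// sib_ratio_mono.
Qed.

Lemma ratio_prod b k : b < 1 ->
  sib_ratio b k.+1 = (2 * b - 1) / (1 - b) ^+ 2 *
    \prod_(j < k) ((1 - 2 * b / j.+2%:R) / (1 - b / j.+2%:R) ^+ 2).
Proof.
move=> b1; elim: k => [|k IH].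
  by rewrite big_ord0 /sib_ratio !sibS !sib0; field; lra.
rewrite big_ord_recr /= [RHS]mulrA -IH /sib_ratio (sibS (2 * b)) (sibS b k.+1).
rewrite exprMn invfM; ring.
Qed.

Lemma ratio_factor_ge0 b j : 0 <= b < 1 ->
  0 <= (1 - 2 * b / j.+2%:R) / (1 - b / j.+2%:R) ^+ 2.
Proof.
move=> hb; rewrite divr_ge0 ?sqr_ge0// subr_ge0 ler_pdivrMr// mul1r.
by rewrite (@le_trans _ _ 2%:R)//; [lra|rewrite ler_nat].
Qed.

(* In terms of [t = b / j], the factor is [1 - (t / (1 - t)) ^+ 2]. *)
Lemma ratio_factor_noninc b b' j : 0 <= b -> b <= b' -> b' <= 1 ->
  (1 - 2 * b' / j.+2%:R) / (1 - b' / j.+2%:R) ^+ 2 <=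
  (1 - 2 * b / j.+2%:R) / (1 - b / j.+2%:R) ^+ 2.
Proof.
move=> b0 bb b1.
have -> : 2 * b' / j.+2%:R = 2 * (b' / j.+2%:R) by rewrite mulrA.
have -> : 2 * b / j.+2%:R = 2 * (b / j.+2%:R) by rewrite mulrA.
have : 0 <= b / j.+2%:R by rewrite divr_ge0.
have : b / j.+2%:R <= b' / j.+2%:R by rewrite ler_pM2r ?invr_gt0.
have : b' / j.+2%:R <= 1 / 2.
  rewrite ler_pdivrMr// mulrC mulrA mulr1 ler_pdivlMr//.
  by rewrite (@le_trans _ _ 2%:R)//; [lra|rewrite ler_nat].
move: (b / _) (b' / _) => s t h1 h2 h3.
have E (u : R) : u <= 1 / 2 -> (1 - 2 * u) / (1 - u) ^+ 2 = 1 - (u / (1 - u)) ^+ 2.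
  by move=> hu; field; lra.
rewrite !E; try lra.
rewrite lerB// ler_sqr ?nnegrE.
- by rewrite ler_pdivrMr; [rewrite mulrAC ler_pdivlMr; nra|lra].
- by rewrite divr_ge0; lra.
- by rewrite divr_ge0; lra.
Qed.

(** The leading factor of [ratio_prod] carries all the growth in [b], since the other factors are
    nonincreasing. Together with [ratio_mono] this squeezes the limit and gives its continuity. *)
Lemma ratio_quot_noninc b b' k : 1 / 2 < b -> b <= b' -> b' < 1 ->
  sib_ratio b' k.+1 * ((2 * b - 1) / (1 - b) ^+ 2) <=
  sib_ratio b k.+1 * ((2 * b' - 1) / (1 - b') ^+ 2).
Proof.
move=> b0 bb b1; rewrite !ratio_prod; try lra.
rewrite [leLHS]mulrAC [leRHS]mulrAC [X in _ <= X * _]mulrC; apply: ler_wpM2l.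
  by apply: mulr_ge0; apply: divr_ge0; rewrite ?sqr_ge0//; lra.
apply: ler_prod => j _; rewrite ratio_factor_ge0/=; last by lra.
by apply: ratio_factor_noninc; lra.
Qed.

(** A bound uniform in [k] that blows up as [b] tends to 1. The factor of denominator 2 is at least
    [1 - b]; those of denominator 3 and more are bounded by their values at [b = 1], whose product
    telescopes and stays above [1 / 2]. *)
Lemma ratio_lower b k : 1 / 2 < b < 1 ->
  (2 * b - 1) / (2 * (1 - b)) <= sib_ratio b k.+2.
Proof.
move=> /andP[b0 b1]; rewrite ratio_prod// big_ord_recl.
have h1 : 1 / 2 <= \prod_(i < k)
    ((1 - 2 * b / (lift ord0 i).+2%:R) / (1 - b / (lift ord0 i).+2%:R) ^+ 2).
  apply: (@le_trans _ _ (\prod_(i < k)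
      ((1 - 2 * 1 / i.+3%:R) / (1 - 1 / i.+3%:R) ^+ 2 : R))).
    have -> : \prod_(i < k) ((1 - 2 * 1 / i.+3%:R) / (1 - 1 / i.+3%:R) ^+ 2) =
        1 / 2 * (k.+2%:R / k.+1%:R) :> R.
      elim: k => [|k IH]; first by rewrite big_ord0; field.
      rewrite big_ord_recr /= IH -!natr1; field.
      have : 0 <= k%:R :> R by []. by lra.
    by rewrite ler_peMr// ler_pdivlMr// mul1r ler_nat.
  apply: ler_prod => j _; rewrite lift0; apply/andP; split; last first.
    by apply: ratio_factor_noninc; lra.
  rewrite divr_ge0 ?sqr_ge0// subr_ge0 ler_pdivrMr// mul1r mulr1.
  by rewrite ler_nat.
have h2 : 1 - b <= (1 - 2 * b / (@ord0 k).+2%:R) / (1 - b / (@ord0 k).+2%:R) ^+ 2.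
  rewrite /= ler_pdivlMr; last by apply: exprn_gt0; lra.
  have -> : 1 - 2 * b / 2 = 1 - b by field.
  by rewrite ler_piMr ?expr_le1//; lra.
have -> : (2 * b - 1) / (2 * (1 - b)) =
    (2 * b - 1) / (1 - b) ^+ 2 * ((1 - b) * (1 / 2)) by field; lra.
apply: ler_wpM2l; first by rewrite divr_ge0 ?sqr_ge0; lra.
by apply: ler_pM => //; lra.
Qed.

(** Bernoulli's inequality for exponents in [[0, 1]]: the combination of [h1] and [h2] with weights
    [b] and [1 - b] cancels the logarithms. *)
Lemma powR_le_linear (u b : R) : 0 < u -> 0 <= b <= 1 -> u `^ b <= 1 + b * (u - 1).
Proof.
move=> u0 /andP[b0 b1]; set m := u `^ b.
have m0 : 0 <= m by exact: powR_ge0.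
have hm : m = expR (b * ln u) by rewrite /m /powR gt_eqF.
have h1 : m * (1 + (1 - b) * ln u) <= u.
  have e : u = m * expR ((1 - b) * ln u).
    by rewrite hm -expRD -mulrDl addrC subrK mul1r lnK.
  by rewrite [leRHS]e ler_wpM2l// expR_ge1Dx.
have h2 : m * (1 - b * ln u) <= 1.
  have e : 1 = m * expR (- (b * ln u)) by rewrite hm -expRD subrr expR0.
  by rewrite [leRHS]e ler_wpM2l// expR_ge1Dx.
nra.
Qed.

(** Bernoulli at [1 + 1 / x] gives [(1 + 1 / x) ^ b <= 1 + t] with [t = b / x], and
    [(1 - t) * (1 + t) <= 1]. *)
Lemma sib_upper b k : 0 <= b < 1 -> sib b k <= k.+1%:R `^ (- b).
Proof.
move=> /andP[b0 b1]; elim: k => [|k IH]; first by rewrite sib0 powR1.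
rewrite sibS; set x : R := k.+1%:R; set y : R := k.+2%:R.
have x0 : 0 < x by rewrite ltr0n.
have y0 : 0 < y by rewrite ltr0n.
have xy : y = x + 1 by rewrite /y -natr1.
have -> : y `^ (- b) = x `^ (- b) * (y / x) `^ (- b).
  by rewrite -powRM ?divr_ge0 ?ltW//; congr (_ `^ _); field; lra.
have bx : b / x < 1 by rewrite ltr_pdivrMr// mul1r; apply: (lt_le_trans b1); rewrite ler1n.
apply: ler_pM => //; first exact/ltW/sib_gt0.
  by rewrite subr_ge0 ltW.
rewrite powRN -[leLHS]invrK lef_pV2 ?posrE ?powR_gt0 ?divr_gt0 ?invr_gt0 ?subr_gt0//.
apply: (le_trans (@powR_le_linear _ b _ _)); [by rewrite divr_gt0|lra|].
rewrite (_ : 1 + _ = 1 + b / x); last by rewrite xy; field; lra.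
have : 0 <= b / x by rewrite divr_ge0// ltW.
move: bx; move: (b / x) => t t1 t0.
by rewrite -div1r ler_pdivlMr; nra.
Qed.

(** Bernoulli at [x / (x + 1)]; the constant [1 - b] is the initial value [sib b 1]. *)
Lemma sib_lower b k : 0 <= b < 1 -> (1 - b) * k.+1%:R `^ (- b) <= sib b k.+1.
Proof.
move=> /andP[b0 b1]; elim: k => [|k IH].
  by rewrite powR1 mulr1 sibS sib0; lra.
rewrite sibS; set x : R := k.+1%:R; set y : R := k.+2%:R.
have x0 : 0 < x by rewrite ltr0n.
have y0 : 0 < y by rewrite ltr0n.
have xy : y = x + 1 by rewrite /y -natr1.
have -> : y `^ (- b) = x `^ (- b) * (x / y) `^ b.
  rewrite powRM ?invr_ge0 ?ltW// mulrA -powRD ?(gt_eqF x0) ?implybT// addNr.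
  by rewrite powRr0 mul1r powRN -[y^-1 in RHS]powR_inv1 ?ltW// -powRrM mulN1r powRN.
rewrite mulrA; apply: ler_pM => //.
- by rewrite mulr_ge0 ?powR_ge0//; lra.
- exact: powR_ge0.
apply: (le_trans (@powR_le_linear _ b _ _)); [by rewrite divr_gt0|lra|].
by rewrite le_eqVlt; apply/orP; left; apply/eqP; rewrite xy; field; lra.
Qed.

End Sibuya.

(** * The limit of the ratio: strict monotonicity, continuity and range *)

Section RatioLimit.
Context {R : realType}.
Implicit Types (a b : R) (k n : nat).

(** The shift leaves out the index 0, where the ratio is [-1] and monotonicity in [k] may fail. *)
Definition ratio_lim b : R := limn (fun k => sib_ratio b k.+1).

Lemma ratio_nonincreasing b : 1 / 2 <= b < 1 ->
  nonincreasing_seq (fun k => sib_ratio b k.+1).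
Proof. by move=> hb; apply/nonincreasing_seqP => k; apply: ratio_noninc. Qed.

Lemma ratio_cvg b : 1 / 2 <= b < 1 ->
  (sib_ratio b k.+1 @[k --> \oo] --> ratio_lim b).
Proof.
move=> hb; apply: nonincreasing_is_cvgn; first exact: ratio_nonincreasing.
by exists 0 => _ [k _ <-]; apply: ratio_ge0.
Qed.

Lemma ratio_lim_le b k : 1 / 2 <= b < 1 -> ratio_lim b <= sib_ratio b k.+1.
Proof.
move=> hb; apply: (nonincreasing_cvgn_ge (ratio_nonincreasing hb)).
apply: cvgP; exact: ratio_cvg.
Qed.

Lemma ratio_lim_ge0 b : 1 / 2 <= b < 1 -> 0 <= ratio_lim b.
Proof.
move=> hb; apply: limr_ge; first by apply: cvgP; exact: ratio_cvg.
by apply: nearW => k; apply: ratio_ge0.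
Qed.

Lemma ratio_lim_lower b : 1 / 2 < b < 1 ->
  (2 * b - 1) / (2 * (1 - b)) <= ratio_lim b.
Proof.
move=> hb; apply: limr_ge.
  by apply: cvgP; apply: ratio_cvg; lra.
by near=> k; have -> : k.+1 = k.-1.+2 by [near: k; exists 1%N => // -[]];
  apply: ratio_lower.
Unshelve. all: by end_near. Qed.

Lemma ratio_lim_upper b : 1 / 2 <= b < 1 ->
  ratio_lim b <= (2 * b - 1) / (1 - b) ^+ 2.
Proof.
move=> hb; apply: (le_trans (ratio_lim_le 0 hb)).
by rewrite ratio_prod ?big_ord0 ?mulr1//; lra.
Qed.

Lemma ratio_lim_mono b b' : 1 / 2 <= b -> b <= b' -> b' < 1 ->
  (ratio_lim b + 1) * b' <= (ratio_lim b' + 1) * b.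
Proof.
move=> b0 bb b1.
have c c1 c2 : 1 / 2 <= c1 < 1 ->
    ((sib_ratio c1 k.+1 + 1) * c2 @[k --> \oo] --> (ratio_lim c1 + 1) * c2).
  move=> hc; apply: cvgMr_tmp; apply: cvgD; first exact: ratio_cvg.
  exact: cvg_cst.
have hb : 1 / 2 <= b < 1 by lra.
have hb' : 1 / 2 <= b' < 1 by lra.
apply: (ler_cvg_to (c b b' hb) (c b' b hb')).
by apply: nearW => k; apply: ratio_mono; lra.
Qed.

Lemma ratio_lim_lt b b' : 1 / 2 <= b -> b < b' -> b' < 1 ->
  ratio_lim b < ratio_lim b'.
Proof.
move=> b0 bb b1; have h := ratio_lim_mono b0 (ltW bb) b1.
have h0 : 0 <= ratio_lim b by apply: ratio_lim_ge0; lra.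
nra.
Qed.

Lemma ratio_lim_quot b b' : 1 / 2 < b -> b <= b' -> b' < 1 ->
  ratio_lim b' * ((2 * b - 1) / (1 - b) ^+ 2) <=
  ratio_lim b * ((2 * b' - 1) / (1 - b') ^+ 2).
Proof.
move=> b0 bb b1.
have c c1 c2 : 1 / 2 <= c1 < 1 ->
    (sib_ratio c1 k.+1 * c2 @[k --> \oo] --> ratio_lim c1 * c2).
  by move=> hc; apply: cvgMr_tmp; exact: ratio_cvg.
have hb : 1 / 2 <= b < 1 by lra.
have hb' : 1 / 2 <= b' < 1 by lra.
apply: (ler_cvg_to (c b' _ hb') (c b _ hb)).
by apply: nearW => k; apply: ratio_quot_noninc; lra.
Qed.


Lemma ratio_lim_eventually b (kap : R) : 1 / 2 <= b < 1 -> ratio_lim b < kap ->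
  exists k0, forall k, (k0 < k)%N -> sib_ratio b k <= kap.
Proof.
move=> hb /(cvgr_lt (ratio_lim b) (ratio_cvg hb)) [k0 _ h].
exists k0 => -[//|k]; rewrite ltnS => hk.
apply: (@le_trans _ _ (sib_ratio b k0.+1)).
  exact: ratio_nonincreasing.
by apply: ltW; apply: (h k0) => /=.
Qed.

Lemma ratio_lim_le_mono b b' : 1 / 2 <= b -> b <= b' -> b' < 1 ->
  ratio_lim b <= ratio_lim b'.
Proof.
move=> h1; rewrite le_eqVlt => /orP[/eqP ->//|h2] h3.
exact/ltW/ratio_lim_lt.
Qed.

Lemma ratio_lim_continuous b : 1 / 2 < b < 1 -> {for b, continuous ratio_lim}.
Proof.
move=> /andP[b0 b1].
pose rho c : R := (2 * c - 1) / (1 - c) ^+ 2.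
have rho_gt0 c : 1 / 2 < c < 1 -> 0 < rho c.
  by move=> hc; rewrite /rho divr_gt0 ?exprn_gt0//; lra.
(* [ratio_lim c] lies between the constant [ratio_lim b] and [g c], on either side of [b]: one bound
   is monotonicity, the other is [ratio_lim_quot]. *)
pose g c := ratio_lim b / rho b * rho c.
have gb : g b = ratio_lim b by rewrite /g divfK// gt_eqF// rho_gt0 ?b0.
have cg : g c @[c --> b] --> ratio_lim b.
  rewrite -gb; apply: cvgMl_tmp; apply: cvgM.
    by apply: cvgB; [apply: cvgMl_tmp; exact: cvg_id|exact: cvg_cst].
  apply: cvgV; first by rewrite expf_neq0//; lra.
  have c1 : (1 - c @[c --> b] --> 1 - b).
    by apply: cvgB; [exact: cvg_cst|exact: cvg_id].
  by rewrite expr2; apply: (cvg_trans _ (cvgM c1 c1)); under eq_fun do rewrite expr2.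
apply/cvgrPdist_le => e e0.
have hg : \forall c \near b, `|ratio_lim b - g c| <= e.
  by move/cvgrPdist_le : cg; apply.
near=> c.
have c0 : 1 / 2 < c by near: c; apply: lt_nbhsr.
have c1 : c < 1 by near: c; apply: lt_nbhsl.
have : `|ratio_lim b - g c| <= e by near: c.
have hbb := rho_gt0 b; have hcc := rho_gt0 c; rewrite b0 b1 c0 c1 in hbb hcc.
have [bc|cb] := leP b c.
  have h1 := ratio_lim_le_mono (ltW b0) bc c1.
  have h2 : ratio_lim c <= g c.
    rewrite /g mulrAC ler_pdivlMr ?hbb//.
    exact: ratio_lim_quot.
  by rewrite !ler0_norm; lra.
have h1 := ratio_lim_le_mono (ltW c0) (ltW cb) b1.
have h2 : g c <= ratio_lim c.
  rewrite /g mulrAC ler_pdivrMr ?hbb//.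
  exact: (ratio_lim_quot c0 (ltW cb) b1).
by rewrite !ger0_norm; lra.
Unshelve. all: by end_near. Qed.

Lemma ratio_lim_surj (kap : R) : 0 < kap ->
  exists2 b, 1 / 2 < b < 1 & ratio_lim b = kap.
Proof.
(* At [x = 1 / 2 + d] the bound [ratio_lim_upper] is [2 * d / (1 - x) ^+ 2 <= 32 * d], because
   [1 - x >= 1 / 4]. *)
move=> k0; pose d := Num.min (1 / 4) (kap / 32).
have d0 : 0 < d by rewrite /d lt_min; lra.
have d1 : d <= 1 / 4 by rewrite /d ge_min lexx.
have d2 : d <= kap / 32 by rewrite /d ge_min lexx orbT.
(* [y] solves [(2 * y - 1) / (2 * (1 - y)) = kap], so [ratio_lim_lower] gives
   [kap <= ratio_lim y]. *)
pose x := 1 / 2 + d; pose y := (1 + 2 * kap) / (2 + 2 * kap).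
have hx : 1 / 2 < x < 1 by rewrite /x; lra.
have hy : 1 / 2 < y < 1.
  by rewrite /y ltr_pdivlMr ?ltr_pdivrMr; lra.
have hKx : ratio_lim x <= kap.
  apply: (le_trans (ratio_lim_upper _)); first by lra.
  rewrite ler_pdivrMr; last by rewrite exprn_gt0; lra.
  have h : 1 / 16 <= (1 - x) ^+ 2 by rewrite /x expr2; nra.
  by apply: (le_trans _ (ler_wpM2l (ltW k0) h)); rewrite /x; lra.
have hKy : kap <= ratio_lim y.
  apply: le_trans (ratio_lim_lower hy).
  rewrite le_eqVlt; apply/orP; left; apply/eqP; rewrite /y; field; lra.
have xy : x <= y.
  rewrite leNgt; apply/negP => yx.
  by have : ratio_lim y < ratio_lim x; [apply: ratio_lim_lt; lra|lra].
have [] := @IVT R ratio_lim x y kap xy.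
- apply: continuous_in_subspaceT => c; rewrite inE/= in_itv/= => hc.
  by apply: ratio_lim_continuous; lra.
- by rewrite ge_min le_max hKx hKy orbT.
- by move=> c; rewrite in_itv/= => hc <-; exists c => //; lra.
Qed.

End RatioLimit.

(** * Positive linear functionals and the distribution of a sum *)

Section PositiveFunctional.
Context {R : realType}.
Implicit Types (E : (nat -> R) -> R) (N phi psi : nat -> R) (k : nat).

(** An expectation whose total mass is left free, so that truncated and weighted sums over trees
    qualify. *)
Definition posfun E :=
  (forall phi psi, (forall a, phi a <= psi a) -> E phi <= E psi) /\
  (forall (c : R) phi psi, E (fun a => c * phi a + psi a) = c * E phi + E psi).

Lemma posfun0 E : posfun E -> E (fun=> 0) = 0.
Proof.
move=> [_ lin]; have := lin (-1) (fun=> 0) (fun=> 0).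
by rewrite (_ : (fun=> _) = (fun=> 0)); [lra|apply: funext => a; ring].
Qed.

Lemma posfun_sum E k (c : nat -> R) (F : nat -> nat -> R) : posfun E ->
  E (fun a => \sum_(i < k) c i * F i a) = \sum_(i < k) c i * E (F i).
Proof.
move=> pE; elim: k => [|k IH].
  rewrite big_ord0; transitivity (E (fun=> 0)); last exact: posfun0.
  by congr E; apply: funext => a; rewrite big_ord0.
rewrite big_ord_recr /= -IH addrC; case: pE => _ <-; congr E.
by apply: funext => a; rewrite big_ord_recr addrC.
Qed.

Lemma sum_incr_trunc N k m : (m <= k)%N ->
  \sum_(i < k) (N i.+1 - N i) * (i < m)%:R = N m - N 0%N.
Proof.
elim: k m => [|k IH] m; first by rewrite leqn0 => /eqP ->; rewrite big_ord0 subrr.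
rewrite big_ord_recr /= leq_eqVlt => /orP[/eqP ->|]; last first.
  by rewrite ltnS => hm; rewrite IH// ltnNge hm mulr0 addr0.
rewrite ltnSn mulr1 (eq_bigr (fun i : 'I_k => (N i.+1 - N i) * (i < k)%:R)).
  by rewrite IH//; ring.
by move=> i _; rewrite (ltn_ord i) ltnS ltnW.
Qed.

(** Summation by parts: [N (k - a)] becomes a combination of indicators in [a], to which a positive
    functional applies term by term. *)
Lemma sum_incr_le N k a : N 0%N = 0 ->
  \sum_(i < k) (N i.+1 - N i) * (a <= k - i.+1)%:R =
  if (a <= k)%N then N (k - a)%N else 0.
Proof.
move=> N0; case: leqP => ha; last first.
  rewrite big1// => i _; have hi := ltn_ord i.
  by rewrite (_ : (a <= k - i.+1)%N = false) ?mulr0//; lia.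
have -> : N (k - a)%N = N (k - a)%N - N 0%N by rewrite N0 subr0.
rewrite -(@sum_incr_trunc N k); last by lia.
apply: eq_bigr => i _; congr (_ * _%:R); have := ltn_ord i; lia.
Qed.

Lemma posfun_sum_le E k a : posfun E ->
  E (fun b => (a + b <= k)%N%:R) =
  if (a <= k)%N then E (fun b => (b <= k - a)%N%:R) else 0.
Proof.
move=> pE; case: leqP => ha.
  by congr E; apply: funext => b; congr _%:R; lia.
transitivity (E (fun=> 0)); last exact: posfun0.
congr E; apply: funext => b.
by rewrite (_ : (a + b <= k)%N = false)//; lia.
Qed.

(** The inner functional is replaced by [N], then [sum_incr_le] lets the outer one be replaced too;
    the monotonicity of [N] keeps the coefficients nonnegative. *)
Lemma posfun_cdf2_le E N k : posfun E -> N 0%N = 0 ->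
  (forall i, N i <= N i.+1) ->
  (forall j, (j <= k)%N -> E (fun a => (a <= j)%N%:R) <= N j) ->
  E (fun a => E (fun b => (a + b <= k)%N%:R)) <= cdf2 N k.
Proof.
move=> pE N0 incr h.
apply: (@le_trans _ _ (E (fun a =>
    \sum_(i < k) (N i.+1 - N i) * (a <= k - i.+1)%N%:R))).
  case: (pE) => mono _; apply: mono => a; rewrite sum_incr_le// posfun_sum_le//.
  by case: leqP => // ha; apply: h; lia.
rewrite (@posfun_sum E k (fun i => N i.+1 - N i) (fun i a => (a <= k - i.+1)%N%:R))//.
apply: ler_sum => i _; apply: ler_wpM2l; first by rewrite subr_ge0.
by apply: h; lia.
Qed.

Lemma posfun_cdf2_ge E N k : posfun E -> N 0%N = 0 ->
  (forall i, N i <= N i.+1) ->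
  (forall j, (j <= k)%N -> N j <= E (fun a => (a <= j)%N%:R)) ->
  cdf2 N k <= E (fun a => E (fun b => (a + b <= k)%N%:R)).
Proof.
move=> pE N0 incr h.
apply: (@le_trans _ _ (E (fun a =>
    \sum_(i < k) (N i.+1 - N i) * (a <= k - i.+1)%N%:R))); last first.
  case: (pE) => mono _; apply: mono => a; rewrite sum_incr_le// posfun_sum_le//.
  by case: leqP => // ha; apply: h; lia.
rewrite (@posfun_sum E k (fun i => N i.+1 - N i) (fun i a => (a <= k - i.+1)%N%:R))//.
apply: ler_sum => i _; apply: ler_wpM2l; first by rewrite subr_ge0.
by apply: h; lia.
Qed.

(** The event that the maximum is at most [k] is a product of events in [a] and [b], hence the
    square. *)
Lemma posfun_join E (p : R) k : posfun E ->
  E (fun a => E (fun b => join p (fun c => (c <= k)%N%:R) a b)) =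
  p * E (fun a => E (fun b => (a + b <= k)%N%:R))
  + (1 - p) * E (fun a => (a <= k)%N%:R) ^+ 2.
Proof.
move=> pE; have lin := pE.2.
have -> : (fun a => E (fun b => join p (fun c => (c <= k)%N%:R) a b)) =
    (fun a => p * E (fun b => (a + b <= k)%N%:R)
      + ((1 - p) * E (fun b => (b <= k)%N%:R)) * (a <= k)%N%:R).
  apply: funext => a.
  have Z c phi : E (fun b => c * phi b) = c * E phi.
    have := lin c phi (fun=> 0); rewrite posfun0// addr0 => <-.
    by congr E; apply: funext => b; rewrite addr0.
  have -> : (1 - p) * E (fun b => (b <= k)%N%:R) * (a <= k)%N%:R =
      E (fun b => (1 - p) * (a <= k)%N%:R * (b <= k)%N%:R) by rewrite Z; ring.
  rewrite -lin; congr E; apply: funext => b; rewrite /join geq_max.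
  by case: (a <= k)%N; case: (b <= k)%N; rewrite /= ?mulr1 ?mulr0.
rewrite lin; congr (_ + _).
have := lin ((1 - p) * E (fun b => (b <= k)%N%:R)) (fun a => (a <= k)%N%:R) (fun=> 0).
rewrite posfun0// addr0 expr2 mulrA => <-.
by congr E; apply: funext => b; rewrite addr0.
Qed.

End PositiveFunctional.

(** * Comparison with the fixed point equation *)

Lemma sum_diag_le (R : realType) (a : nat -> nat -> R) N :
  (forall i j, 0 <= a i j) ->
  \sum_(m < N) \sum_(i < m.+1) a i (m - i)%N <= \sum_(i < N) \sum_(j < N) a i j.
Proof.
move=> a0.
have -> : \sum_(m < N) \sum_(i < m.+1) a i (m - i)%N =
    \sum_(i < N) \sum_(j < N - i) a i j.
  elim: N => [|N IH]; first by rewrite !big_ord0.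
  rewrite big_ord_recr /= IH [RHS]big_ord_recr /= subSn// subnn big_ord1.
  rewrite big_ord_recr /= subnn addrA -big_split /=; congr (_ + _).
  apply: eq_bigr => i _; have hi := ltn_ord i.
  by rewrite subSn 1?ltnW// big_ord_recr.
apply: ler_sum => i _; rewrite (big_ord_widen N (a i)) ?leq_subr//.
by rewrite big_mkcond /=; apply: ler_sum => j _; case: ifP.
Qed.

Section Comparison.
Context {R : realType} (p : R) (hp0 : 0 < p) (hp1 : p < 1).
Implicit Types (phi psi : nat -> R).

(* Galton-Watson expectation of [z ^+ (number of leaves) * phi (lis t)],
   restricted to trees with at most [N] leaves. *)
Definition gsum (z : R) N phi : R :=
  \sum_(n < N) z ^+ n.+1 / (2 * 4 ^+ n) * lsum p n phi.

Lemma gsum_coef_ge0 (z : R) n : 0 <= z -> 0 <= z ^+ n.+1 / (2 * 4 ^+ n).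
Proof. by move=> z0; rewrite divr_ge0 ?mulr_ge0 ?exprn_ge0. Qed.

Lemma gsum_le_pos (z : R) N phi psi : 0 <= z ->
  (forall a, (0 < a)%N -> phi a <= psi a) -> gsum z N phi <= gsum z N psi.
Proof.
move=> z0 h; apply: ler_sum => n _; apply: ler_wpM2l.
  exact: gsum_coef_ge0.
exact: lsum_le.
Qed.

Lemma gsum_posfun (z : R) N : 0 <= z -> posfun (gsum z N).
Proof.
move=> z0; split=> [phi psi h|c phi psi]; first by apply: gsum_le_pos.
rewrite /gsum mulr_sumr -big_split /=; apply: eq_bigr => n _.
by rewrite lsumZD; ring.
Qed.

Lemma lsum_sum n k (F : nat -> nat -> R) :
  lsum p n (fun a => \sum_(j < k) F j a) = \sum_(j < k) lsum p n (F j).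
Proof.
rewrite /lsum exchange_big /=; apply: eq_bigr => t _.
by rewrite mulr_sumr.
Qed.

(** Decomposition at the root. It is an inequality because two subtrees with at most [N] leaves each
    may together have more than [N + 1]. *)
Lemma gsum_rec (z : R) N phi : 0 <= z -> (forall a, 0 <= phi a) ->
  gsum z N.+1 phi <=
  z / 2 * phi 1%N + 1 / 2 * gsum z N (fun a => gsum z N (fun b => join p phi a b)).
Proof.
move: hp0 hp1 => q0 q1 z0 phi0.
rewrite {1}/gsum big_ord_recl lsum0 expr0 mulr1 expr1; apply: lerD => //.
pose cz n : R := z ^+ n.+1 / (2 * 4 ^+ n).
pose T i j := lsum p i (fun a => lsum p j (fun b => join p phi a b)).
have -> : 1 / 2 * gsum z N (fun a => gsum z N (fun b => join p phi a b)) =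
    \sum_(i < N) \sum_(j < N) 1 / 2 * (cz i * cz j * T i j).
  rewrite /gsum mulr_sumr; apply: eq_bigr => i _.
  rewrite (@lsum_sum i N (fun j a => cz j * lsum p j (fun b => join p phi a b))).
  rewrite !mulr_sumr; apply: eq_bigr => j _.
  by rewrite lsumZ /T /cz; ring.
apply: le_trans (@sum_diag_le R (fun i j => 1 / 2 * (cz i * cz j * T i j)) N _).
  apply: ler_sum => n _; rewrite lift0 lsumS mulr_sumr.
  apply: ler_sum => i _; rewrite -/(T _ _) mulrA; apply: ler_wpM2r.
    rewrite /T /lsum sumr_ge0// => t _; rewrite mulr_ge0 ?weight_ge0//.
    rewrite sumr_ge0// => u _; rewrite mulr_ge0 ?weight_ge0//.
    by rewrite /join addr_ge0// mulr_ge0//; lra.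
  have hi : (i <= n)%N by rewrite -ltnS.
  rewrite /cz le_eqVlt; apply/orP; left; apply/eqP.
  rewrite -{1 2}(subnKC hi); move: (n - i)%N => j.
  rewrite -addnS -!addSn !exprD !exprS; field.
  by rewrite !expf_neq0.
move=> i j; apply: mulr_ge0; first by lra.
apply: mulr_ge0; first by apply: mulr_ge0; apply: gsum_coef_ge0.
rewrite /T /lsum sumr_ge0// => t _; rewrite mulr_ge0 ?weight_ge0//.
rewrite sumr_ge0// => u _; rewrite mulr_ge0 ?weight_ge0//.
by rewrite /join addr_ge0// mulr_ge0//; lra.
Qed.

Lemma gsum_term (z : R) n phi : 0 <= z -> (forall a, 0 <= phi a) ->
  z ^+ n.+1 / (2 * 4 ^+ n) * lsum p n phi <= gsum z n.+1 phi.
Proof.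
move=> z0 phi0; rewrite /gsum big_ord_recr /= lerDr sumr_ge0// => i _.
rewrite mulr_ge0 ?gsum_coef_ge0//.
by rewrite /lsum sumr_ge0// => t _; rewrite mulr_ge0 ?weight_ge0.
Qed.

(** Above the critical [b] the fixed point inequality for [1 - sib b k] has a margin proportional to
    [sib b k ^+ 2]. For [k <= x] it pays for [z - 1], so [z] may exceed 1. *)
Lemma gsum_cdf_le (b : R) x N k : 1 / 2 < b < 1 ->
  1 - p < p * ratio_lim b -> (k <= x)%N ->
  gsum (1 + (p * ratio_lim b - (1 - p)) * sib b x ^+ 2) N
    (fun a => (a <= k)%N%:R) <= 1 - sib b k.
Proof.
move: hp0 hp1 => q0 q1 /andP[b0 b1] hc.
have hb : 0 <= b < 1 by lra.
set c := _ - (1 - p); set z := 1 + _.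
have c0 : 0 < c by rewrite /c; lra.
have z0 : 0 <= z by rewrite /z addr_ge0// mulr_ge0 ?sqr_ge0// ltW.
elim: N k => [|N IH] k kx; first by rewrite /gsum big_ord0 subr_ge0 sib_le1.
case: k kx => [|k] kx.
  rewrite sib0 subrr -(posfun0 (gsum_posfun N.+1 z0)); apply: gsum_le_pos => //.
  by case.
have pE := gsum_posfun N z0.
apply: (le_trans (gsum_rec _ z0 _)) => //.
rewrite mulr1 posfun_join//.
set A := sib b k.+1; have A0 : 0 < A by exact: sib_gt0.
have h1 : gsum z N (fun a => gsum z N (fun b => (a + b <= k.+1)%N%:R)) <=
    1 - 2 * A + sib (2 * b) k.+1.
  have -> : 1 - 2 * A + sib (2 * b) k.+1 = cdf2 (fun i => 1 - sib b i) k.+1.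
    by rewrite cdf2_excess ?sib0// excess_sib -/A; ring.
  apply: posfun_cdf2_le => //; first by rewrite sib0 subrr.
    by move=> i; rewrite lerB// sib_noninc.
  by move=> j jk; apply: IH; apply: leq_trans kx.
have h2 : gsum z N (fun a => (a <= k.+1)%N%:R) ^+ 2 <= (1 - A) ^+ 2.
  rewrite ler_sqr ?nnegrE; first exact: IH.
    by rewrite -(posfun0 pE); apply: pE.1.
  by rewrite subr_ge0 sib_le1.
have h3 : ratio_lim b * A ^+ 2 <= - sib (2 * b) k.+1.
  by rewrite ratioE// ler_wpM2r ?sqr_ge0// ratio_lim_le//; lra.
have h4 : c * sib b x ^+ 2 <= c * A ^+ 2.
  rewrite ler_wpM2l ?(ltW c0)// ler_sqr ?nnegrE ?(ltW (sib_gt0 _ b1))//.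
  exact: sib_noninc_le.
have h1' := ler_wpM2l (ltW q0) h1.
have q2 : 0 <= 1 - p by lra.
have h2' := ler_wpM2l q2 h2.
have h3' := ler_wpM2l (ltW q0) h3.
(* The bounds add up to [1 - A + c * (sib b x ^+ 2 - A ^+ 2) / 2], which is at most [1 - A]. *)
rewrite /z; move: h1' h2' h4; rewrite /c; nra.
Qed.

(** A single term of the generating function is at most the whole, hence at most 1. *)
Lemma lsum_cdf_le (b : R) x n : 1 / 2 < b < 1 -> 1 - p < p * ratio_lim b ->
  lsum p n (fun a => (a <= x)%N%:R) / ntrees p n * gw p n *
  (1 + (p * ratio_lim b - (1 - p)) * sib b x ^+ 2) ^+ n.+1 <= 1.
Proof.
move: (hp0) (hp1) => q0 q1 hb hc.
set z := 1 + _.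
have z0 : 0 <= z.
  by rewrite /z addr_ge0// mulr_ge0 ?sqr_ge0//; lra.
have h := @gsum_cdf_le b x n.+1 x hb hc (leqnn x).
rewrite -/z in h.
have h' := @gsum_term z n (fun a => (a <= x)%N%:R) z0 (fun a => ler0n _ _).
have hs := sib_gt0 x (proj2 (andP hb)).
have -> : lsum p n (fun a => (a <= x)%N%:R) / ntrees p n * gw p n * z ^+ n.+1 =
    z ^+ n.+1 / (2 * 4 ^+ n) * lsum p n (fun a => (a <= x)%N%:R).
  rewrite /gw; field; rewrite expf_neq0//=.
  by rewrite gt_eqF// ntrees_gt0.
by apply: (le_trans h'); apply: (le_trans h); lra.
Qed.

Lemma gsum_mass N : gsum 1 N (fun=> 1) <= 1.
Proof.
elim: N => [|N IH]; first by rewrite /gsum big_ord0.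
apply: (le_trans (gsum_rec _ _ _)) => //.
have pE := gsum_posfun N (@ler01 R).
set f := gsum 1 N (fun=> 1) in IH *.
have f0 : 0 <= f by rewrite -(posfun0 pE); apply: pE.1.
have -> : gsum 1 N (fun a => gsum 1 N (fun b => join p (fun=> 1) a b)) = f * f.
  transitivity (gsum 1 N (fun a => f * 1 + 0)); last first.
    by rewrite pE.2 posfun0// addr0.
  congr gsum; apply: funext => a; rewrite mulr1 addr0; congr gsum.
  by apply: funext => b; rewrite /join; ring.
nra.
Qed.

(* Adding the missing mass at [0] makes [gsum 1 N] an expectation and only
   increases it on nonnegative functions. *)
Lemma gsum_tail_le (b : R) : 1 / 2 < b < 1 -> p * ratio_lim b < 1 - p ->
  exists2 C, 0 < C & forall N k, gsum 1 N (fun a => (k < a)%N%:R) <= C * sib b k.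
Proof.
move: hp0 hp1 => q0 q1 /andP[b0 b1] hc.
have hb : 0 <= b < 1 by lra.
have hK : ratio_lim b < (1 - p) / p by rewrite ltr_pdivlMr// mulrC.
have [|k0 hk0] := @ratio_lim_eventually _ b ((1 - p) / p) _ hK; first by lra.
(* With this [C] the truncated tail [G] equals 1 up to [k0]; wherever [G < 1], the ratio is already
   at most [(1 - p) / p]. *)
pose C := (sib b k0)^-1.
have s0 k : 0 < sib b k by exact: sib_gt0.
have C0 : 0 < C by rewrite invr_gt0.
have C1 : 1 <= C by rewrite invf_ge1// sib_le1.
exists C => // N k; pose G j := Num.min 1 (C * sib b j).
suff : gsum 1 N (fun a => (k < a)%N%:R) <= G k.
  by move/le_trans; apply; rewrite /G ge_min lexx orbT.
have G0 : G 0%N = 1 by rewrite /G sib0 mulr1; apply/min_idPl.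
have Gle1 j : G j <= 1 by rewrite /G ge_min lexx.
have Gge0 j : 0 <= G j by rewrite /G le_min ler01 mulr_ge0// ltW.
have CS j m : (j <= m)%N -> C * sib b m <= C * sib b j.
  by move=> jm; rewrite ler_pM2l// sib_noninc_le.
have Gmono j m : (j <= m)%N -> G m <= G j.
  by move=> jm; rewrite /G le_min !ge_min lexx CS// orbT.
(* Truncation at 1 only shrinks increments, so [excess G] is at most the excess of the untruncated
   tail [C * sib b]. *)
have GLip j m : (j <= m)%N -> G j - G m <= C * (sib b j - sib b m).
  move=> jm; have := CS _ _ jm; rewrite mulrBr /G => h.
  by case: (leP 1 (C * sib b m)) => hm; case: (leP 1 (C * sib b j)) => hj; lra.
elim: N k => [|N IH] k; first by rewrite /gsum big_ord0.
have [hk|hk] := leP 1 (C * sib b k).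
  rewrite /G (min_idPl hk); apply: le_trans (gsum_mass N.+1).
  by apply: gsum_le_pos => // a _; case: (k < a)%N.
have hkk : (k0 < k)%N.
  rewrite ltnNge; apply/negP => kk0.
  have : C * sib b k0 <= C * sib b k by rewrite ler_pM2l// sib_noninc_le.
  by rewrite /C mulVf ?gt_eqF// -/C; lra.
have Gk : G k = C * sib b k by rewrite /G (min_idPr (ltW hk)).
pose f := gsum 1 N (fun=> 1); have f1 : f <= 1 by exact: gsum_mass.
have pS := gsum_posfun N (@ler01 R).
pose E phi := gsum 1 N phi + (1 - f) * phi 0%N.
have pE : posfun E.
  split=> [phi psi h|c phi psi]; last by rewrite /E pS.2; ring.
  by rewrite /E lerD ?pS.1// ler_wpM2l ?subr_ge0.
have E1 : E (fun=> 1) = 1 by rewrite /E -/f; ring.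
have SE phi : (forall a, 0 <= phi a) -> gsum 1 N phi <= E phi.
  by move=> h; rewrite /E lerDl mulr_ge0// subr_ge0.
have Ele j : 1 - G j <= E (fun a => (a <= j)%N%:R).
  have -> : E (fun a => (a <= j)%N%:R) = 1 - gsum 1 N (fun a => (j < a)%N%:R).
    have := pE.2 (-1) (fun a => (j < a)%N%:R) (fun=> 1).
    rewrite E1 {2}/E mulr0 addr0 mulN1r addrC => <-; congr E.
    by apply: funext => a; rewrite ltnNge; case: (a <= j)%N => /=; ring.
  by rewrite lerB// IH.
have join0 a c : 0 <= join p (fun a => (k < a)%N%:R) a c.
  by rewrite /join addr_ge0// mulr_ge0//; lra.
apply: (le_trans (gsum_rec _ _ _)) => //.
rewrite (_ : (k < 1)%N = false) ?mulr0 ?add0r; last first.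
  by rewrite ltnS leqn0 gtn_eqF// (leq_ltn_trans _ hkk).
have h1 : gsum 1 N (fun a => gsum 1 N (fun c => join p (fun a => (k < a)%N%:R) a c))
    <= E (fun a => E (fun c => join p (fun a => (k < a)%N%:R) a c)).
  apply: (@le_trans _ _ (gsum 1 N
      (fun a => E (fun c => join p (fun a => (k < a)%N%:R) a c)))).
    by apply: pS.1 => a; apply: SE.
  by apply: SE => a; rewrite -(posfun0 pE); apply: pE.1.
have h2 : E (fun a => E (fun c => join p (fun a => (k < a)%N%:R) a c)) =
    1 - E (fun a => E (fun c => join p (fun a => (a <= k)%N%:R) a c)).
  have cmpl phi : E (fun a => 1 - phi a) = 1 - E phi.
    rewrite -[X in X - _]E1 addrC -mulN1r -pE.2; congr E.
    by apply: funext => a; ring.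
  rewrite -cmpl; congr E; apply: funext => a; rewrite -cmpl; congr E.
  apply: funext => c; rewrite /join !ltnNge.
  by case: (_ <= k)%N; case: (_ <= k)%N => /=; ring.
rewrite h2 posfun_join// in h1.
have h3 : cdf2 (fun i => 1 - G i) k <= E (fun a => E (fun c => (a + c <= k)%N%:R)).
  apply: posfun_cdf2_ge => //; first by rewrite G0 subrr.
  by move=> i; rewrite lerB// Gmono.
rewrite cdf2_excess// in h3.
have h4 : excess G k <= G k ^+ 2 * (1 + sib_ratio b k).
  have -> : G k ^+ 2 * (1 + sib_ratio b k) = C ^+ 2 * excess (sib b) k.
    by rewrite Gk excess_sib ratioE//; ring.
  rewrite /excess mulr_sumr; apply: ler_sum => i _.
  rewrite (_ : C ^+ 2 * _ = (C * (sib b i - sib b i.+1)) *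
    (C * (sib b (k - i.+1)%N - sib b k))); last by ring.
  apply: ler_pM; rewrite ?subr_ge0 ?GLip ?leq_subr ?leqnSn//.
  - by rewrite Gmono.
  - by rewrite Gmono ?leq_subr.
have h5 : (1 - G k) ^+ 2 <= E (fun a => (a <= k)%N%:R) ^+ 2.
  rewrite ler_sqr ?nnegrE ?subr_ge0//.
  by rewrite -(posfun0 pE); apply: pE.1.
have h6 : p * sib_ratio b k <= 1 - p by rewrite mulrC -ler_pdivlMr// hk0.
have h3' := ler_wpM2l (ltW q0) h3.
have h4' := ler_wpM2l (ltW q0) h4.
have q2 : 0 <= 1 - p by lra.
have h5' := ler_wpM2l q2 h5.
have h6' := ler_wpM2l (sqr_ge0 (G k)) h6.
(* With [r = sib_ratio b k] the bounds add up to [G k + G k ^+ 2 * (p * r - (1 - p)) / 2], which is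
   at most [G k]. *)
move: h1 h3' h4' h5' h6'; move: (E _) (E _) (gsum _ _ _) (sib_ratio _ _) (excess _ _).
move=> *; nra.
Qed.

End Comparison.

(** * The Gamma function *)

Section GammaFunction.
Context {R : realType}.
Local Notation mu := (@lebesgue_measure R).
Implicit Types (x t : R) (n : nat).

Lemma cvg_natpow0 k x : 0 < x -> ((k + n)%:R `^ (- x) : R) @[n --> \oo] --> (0 : R).
Proof.
move=> x0; apply/cvgrPdist_le => e e0; near=> n.
rewrite sub0r normrN ger0_norm ?powR_ge0//.
have h : e `^ (- x^-1) <= (k + n)%:R.
  apply: (@le_trans _ _ n%:R); last by rewrite ler_nat leq_addl.
  by near: n; exact: nbhs_infty_ger.
have hn : 0 < (k + n)%:R :> R by apply: lt_le_trans h; rewrite powR_gt0.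
have he : e = (e `^ (- x^-1)) `^ (- x).
  by rewrite -powRrM mulrNN mulVf ?gt_eqF// powRr1// ltW.
rewrite [leRHS]he powRN [leRHS]powRN lef_pV2 ?posrE ?powR_gt0//.
by apply: ge0_ler_powR; rewrite ?nnegrE ?powR_ge0 ?(ltW x0) ?(ltW hn).
Unshelve. all: by end_near. Qed.

Lemma cvg_natinv0 : (n.+2%:R^-1 : R) @[n --> \oo] --> (0 : R).
Proof.
rewrite (_ : (fun n => n.+2%:R^-1) = (fun n => (2 + n)%:R `^ (-1) : R)).
  exact: cvg_natpow0.
by apply: funext => n; rewrite powR_inv1.
Qed.

(** Monotone convergence along compact intervals. The endpoint sequence is kept general because the
    substitution [t = u ^+ 2] squares it. *)
Lemma cut_cvg (c : nat -> R) (f : R -> R) :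
  (forall n, n.+2%:R <= c n) -> {homo c : m n / (m <= n)%N >-> m <= n} ->
  measurable_fun setT f -> (forall t, 0 < t -> 0 <= f t) ->
  (\int[mu]_(t in `[(c n)^-1%R, c n]) (f t)%:E)%E @[n --> \oo] -->
  (\int[mu]_(t in `]0%R, +oo[) (f t)%:E)%E.
Proof.
move=> cn c_mono mf f0.
have c0 n : 0 < c n by apply: lt_le_trans (cn n).
have -> : `]0%R, +oo[%classic = \bigcup_n `[(c n)^-1, c n]%classic.
  apply/seteqP; split=> t /=; rewrite ?in_itv/= ?andbT.
    move=> t0; pose m := Num.truncn (Num.max t t^-1).
    have h : Num.max t t^-1 < m.+1%:R by exact: truncnS_gt.
    exists m => //=; rewrite in_itv/=; have := cn m.
    move: h; rewrite gt_max => /andP[h1 h2] h3.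
    have hm : m.+1%:R <= m.+2%:R :> R by rewrite ler_nat.
    rewrite (ltW (lt_le_trans h1 (le_trans hm h3))) andbT.
    by rewrite invf_ple ?posrE//; apply/ltW/(lt_le_trans h2 (le_trans hm h3)).
  by move=> [n _]/=; rewrite in_itv/= => /andP[h _]; apply: lt_le_trans h; rewrite invr_gt0.
apply: ge0_nondecreasing_set_cvg_integral.
- move=> m n mn; apply/subsetPset => t /=; rewrite !in_itv/= => /andP[h1 h2].
  rewrite (le_trans h2 (c_mono _ _ mn)) andbT (le_trans _ h1)//.
  by rewrite lef_pV2 ?posrE// c_mono.
- by move=> n; exact: measurable_itv.
- by move=> n; apply/measurable_EFinP; exact: measurable_funTS.
- move=> n t /=; rewrite in_itv/= => /andP[h _]; rewrite lee_fin f0//.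
  by apply: lt_le_trans h; rewrite invr_gt0.
Qed.

Lemma within_cut (f : R -> R) (a b : R) : 0 < a ->
  (forall t, 0 < t -> {for t, continuous f}) -> {within `[a, b], continuous f}.
Proof.
move=> a0 cf; apply: continuous_in_subspaceT => t; rewrite inE/= in_itv/=.
by move=> /andP[h _]; apply: cf; apply: lt_le_trans h.
Qed.

Lemma ftc_cut (F f : R -> R) (a b : R) : 0 < a -> a < b ->
  (forall t, 0 < t -> is_derive t 1 F (f t)) ->
  (forall t, 0 < t -> {for t, continuous f}) ->
  (\int[mu]_(t in `[a, b]) f t)%R = F b - F a.
Proof.
move=> a0 ab dF cf.
have cF t : 0 < t -> {for t, continuous F}.
  move=> t0; apply: differentiable_continuous; apply/derivable1_diffP.
  by have [] := dF t t0.
rewrite /Rintegral (@continuous_FTC2 _ _ F)//.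
- exact: within_cut.
- split.
  + by move=> t; rewrite in_itv/= => /andP[h _]; have [] := dF t (lt_trans a0 h).
  + by apply: cvg_at_right_filter; apply: cF.
  + by apply: cvg_at_left_filter; apply: cF; apply: lt_trans ab.
- move=> t; rewrite in_itv/= => /andP[h _].
  by rewrite derive1E; have [_ ->] := dF t (lt_trans a0 h).
Qed.

Lemma integrable_cut (f : R -> R) (a b : R) : 0 < a ->
  (forall t, 0 < t -> {for t, continuous f}) ->
  mu.-integrable `[a, b] (EFin \o f).
Proof.
move=> a0 cf; apply: continuous_compact_integrable; first exact: segment_compact.
exact: within_cut.
Qed.

Definition gamma_fun x t : R := t `^ (x - 1) * expR (- t).

Lemma gamma_fun_ge0 x t : 0 <= gamma_fun x t.
Proof. by rewrite mulr_ge0 ?powR_ge0 ?expR_ge0. Qed.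

Lemma powR_continuous x t : 0 < t -> {for t, continuous (fun s : R => s `^ x)}.
Proof.
move=> t0; apply: differentiable_continuous; apply/derivable1_diffP.
by have [] := is_derive1_powR x t0.
Qed.

Lemma gamma_fun_continuous x t : 0 < t -> {for t, continuous (gamma_fun x)}.
Proof.
move=> t0; apply: continuousM; first exact: powR_continuous.
apply: continuous_comp; first exact: continuousN.
exact: continuous_expR.
Qed.

Lemma measurable_gamma_fun x : measurable_fun setT (gamma_fun x).
Proof.
apply: measurable_funM; first exact: measurable_powR.
by apply: measurableT_comp => //.
Qed.

(** The cut at [n + 2] keeps the interval away from 0 and nondegenerate. *)
Definition gamma_cut n x : R :=
  (\int[mu]_(t in `[(n.+2%:R)^-1, n.+2%:R]) gamma_fun x t)%R.

Lemma cut_bounds n : (0 < (n.+2%:R)^-1 :> R) /\ ((n.+2%:R)^-1 < n.+2%:R :> R).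
Proof.
split; first by rewrite invr_gt0.
by apply: (@lt_trans _ _ 1); rewrite ?invf_lt1 ?ltr1n.
Qed.

Lemma is_derive_powexp x t : 0 < t ->
  is_derive t 1 (fun s : R => s `^ x * expR (- s)) (x * gamma_fun x t - gamma_fun (x + 1) t).
Proof.
move=> t0.
have h1 := is_derive1_powR x t0.
have h2 : is_derive t 1 (fun s : R => expR (- s)) (- expR (- t)).
  have h := @is_deriveN _ _ _ id t 1 1 (is_derive_id t 1).
  have h' := @is_derive1_comp R expR (fun s => - s) t (expR (- t)) (-1)
    (is_derive_expR (- t)) h.
  by rewrite mulrN1 in h'.
have h3 := is_deriveM h1 h2.
apply: (is_derive_eq h3); rewrite /gamma_fun addrK /GRing.scale /=; ring.
Qed.

(** Integration by parts, read off the derivative of [t ^ x * exp (- t)]; the last terms are the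
    boundary values. *)
Lemma gamma_cut_rec n x :
  gamma_cut n (x + 1) = x * gamma_cut n x -
    (n.+2%:R `^ x * expR (- n.+2%:R)
     - (n.+2%:R)^-1 `^ x * expR (- (n.+2%:R)^-1)).
Proof.
have [a0 ab] := cut_bounds n.
have ig y := integrable_cut (n.+2%:R) a0 (@gamma_fun_continuous y).
have cx t : 0 < t -> {for t, continuous (fun t => x * gamma_fun x t)}.
  move=> t0.
  by apply: continuousM; [exact: cst_continuous|exact: gamma_fun_continuous].
have cf t : 0 < t -> {for t, continuous
    (fun t => x * gamma_fun x t - gamma_fun (x + 1) t)}.
  move=> t0; apply: continuousB; last exact: gamma_fun_continuous.
  exact: cx.
have /= <- := ftc_cut a0 ab (@is_derive_powexp x) cf.
have igx := integrable_cut (n.+2%:R) a0 cx.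
rewrite RintegralB// RintegralZl// /gamma_cut; ring.
Qed.

(** From [1 + t ^ x <= 2 + t <= 2 * exp (t / 2)] the integrand is at most [4 / x] times the
    derivative of [- 1 / (1 + t ^ x)], a function whose increments are at most 1. *)
Lemma gamma_cut_bounded_le1 n x : 0 < x -> x <= 1 -> gamma_cut n x <= 4 / x.
Proof.
move=> x0 x1; have [a0 ab] := cut_bounds n.
pose g t : R := x * t `^ (x - 1) / (1 + t `^ x) ^+ 2.
have d0 t : 0 < 1 + t `^ x by rewrite ltr_pwDl// powR_ge0.
have dF t : 0 < t -> is_derive t 1 (fun s => - (1 + s `^ x)^-1) (g t).
  move=> t0; have h1 := is_derive1_powR x t0.
  have h2 := is_deriveD (is_derive_cst (1 : R) t 1) h1.
  have h3 := is_deriveN (@is_deriveV R (fun s => 1 + s `^ x) t _ 1 (lt0r_neq0 (d0 t)) h2).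
  apply: (is_derive_eq h3).
  by rewrite add0r /g /GRing.scale /= mulNr opprK mulrC.
have cg t : 0 < t -> {for t, continuous g}.
  move=> t0; apply: continuousM.
    by apply: continuousM; [exact: cst_continuous|exact: powR_continuous].
  have c1 : {for t, continuous (fun s : R => 1 + s `^ x)}.
    by apply: continuousD; [exact: cst_continuous|exact: powR_continuous].
  apply: (@continuousV _ _ (fun s : R => (1 + s `^ x) ^+ 2)).
    by rewrite expf_neq0// gt_eqF.
  have -> : (fun s : R => (1 + s `^ x) ^+ 2) =
    (fun s : R => (1 + s `^ x) * (1 + s `^ x)) by apply: funext => s; rewrite expr2.
  exact: continuousM.
have cg' t : 0 < t -> {for t, continuous (fun t => 4 / x * g t)}.
  by move=> t0; apply: continuousM; [exact: cst_continuous|exact: cg].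
apply: (@le_trans _ _ (\int[mu]_(t in `[(n.+2%:R)^-1, n.+2%:R]) (4 / x * g t))%R).
  apply: le_Rintegral => //.
  - exact: integrable_cut (@gamma_fun_continuous x).
  - exact: integrable_cut cg'.
  move=> t /=; rewrite in_itv/= => /andP[h _].
  have t0 : 0 < t := lt_le_trans a0 h.
  have -> : 4 / x * g t = t `^ (x - 1) * (4 / (1 + t `^ x) ^+ 2).
    by rewrite /g; field; rewrite !gt_eqF.
  rewrite ler_wpM2l ?powR_ge0// expRN ler_pdivlMr ?exprn_gt0// mulrC.
  rewrite ler_pdivrMr ?expR_gt0//.
  have h1 : t `^ x <= 1 + x * (t - 1) by apply: powR_le_linear => //; lra.
  have h2 : 1 + t / 2 <= expR (t / 2) by exact: expR_ge1Dx.
  have -> : expR t = expR (t / 2) ^+ 2.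
    by rewrite expr2 -expRD; congr expR; field.
  have h3 : 1 + t `^ x <= 2 * expR (t / 2) by nra.
  have -> : 4 * expR (t / 2) ^+ 2 = (2 * expR (t / 2)) ^+ 2 by ring.
  by rewrite ler_sqr ?nnegrE// ?mulr_ge0 ?expR_ge0// ltW.
have ig := integrable_cut (n.+2%:R) a0 cg.
rewrite RintegralZl// (ftc_cut a0 ab dF cg).
rewrite -[leRHS]mulr1; apply: ler_wpM2l; first by rewrite divr_ge0// ltW.
rewrite opprK addrC lerBlDr; apply: (@le_trans _ _ 1).
  by rewrite invf_le1// lerDl powR_ge0.
by rewrite lerDl invr_ge0 ltW.
Qed.

Lemma powexp_le1 x t : 0 < x -> 0 < t -> t <= 1 -> t `^ x * expR (- t) <= 1.
Proof.
move=> x0 t0 t1; rewrite -[leRHS]mulr1; apply: ler_pM; rewrite ?powR_ge0 ?expR_ge0//.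
  by rewrite -(powRr0 t); apply: ger_powR => //; [rewrite t0 t1|rewrite ltW].
by rewrite expR_le1 lerNl oppr0 ltW.
Qed.

Lemma gamma_cut_bounded x : 0 < x -> exists M, forall n, gamma_cut n x <= M.
Proof.
have [m hm] : exists m : nat, x <= m.+1%:R.
  by exists (Num.truncn x); apply/ltW/truncnS_gt.
elim: m x hm => [|m IH] x hm x0.
  by exists (4 / x) => n; apply: gamma_cut_bounded_le1.
have [x1|x1] := leP x 1; first by exists (4 / x) => n; apply: gamma_cut_bounded_le1.
have y0 : 0 < x - 1 by rewrite subr_gt0.
have [||M hM] := IH (x - 1) => //; first by rewrite lerBlDr natr1.
exists ((x - 1) * M + 1) => n.
rewrite -[x in gamma_cut n x](subrK 1) gamma_cut_rec.
have [a0 ab] := cut_bounds n.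
have h1 : n.+2%:R^-1 `^ (x - 1) * expR (- n.+2%:R^-1) <= 1 :> R.
  by apply: powexp_le1 => //; rewrite invf_le1// ler1n.
have h2 : 0 <= n.+2%:R `^ (x - 1) * expR (- n.+2%:R) :> R.
  by rewrite mulr_ge0 ?powR_ge0 ?expR_ge0.
have h3 := ler_wpM2l (ltW y0) (hM n).
lra.
Qed.

Lemma gamma_cut_cvg x : 0 < x -> gamma_cut n x @[n --> \oo] --> Gamma_pos x.
Proof.
move=> x0; have [M hM] := gamma_cut_bounded x0.
have E n : (\int[mu]_(t in `[n.+2%:R^-1%R, n.+2%:R]) (gamma_fun x t)%:E)%E =
    (gamma_cut n x)%:E.
  have [a0 ab] := cut_bounds n.
  rewrite /gamma_cut /Rintegral fineK//; apply: integrable_fin_num => //.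
  exact: integrable_cut (@gamma_fun_continuous x).
have : (gamma_cut n x)%:E @[n --> \oo] -->
    (\int[mu]_(t in `]0%R, +oo[) (gamma_fun x t)%:E)%E.
  under eq_cvg do rewrite -E.
  apply: (@cut_cvg (fun n => n.+2%:R)) => //.
  - by move=> m n mn; rewrite ler_nat.
  - exact: measurable_gamma_fun.
  - by move=> t _; exact: gamma_fun_ge0.
move=> h; apply: (@fine_cvg _ _ _ _ (fun n => (gamma_cut n x)%:E)).
(* [Gamma_pos] is the [fine] of an extended integral; the bound [M] is what excludes the value
   [+oo]. *)
rewrite fineK; first exact: h.
rewrite ge0_fin_numE; last by apply: integral_ge0 => t _; rewrite lee_fin gamma_fun_ge0.
apply: (@le_lt_trans _ _ M%:E); last exact: ltry.
have <- := cvg_lim (@ereal_hausdorff R) h.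
apply: lime_le; first by apply: cvgP; exact: h.
by apply: nearW => n; rewrite lee_fin.
Qed.

Lemma powexp_cvg0 x : 0 < x ->
  ((n.+2%:R `^ x * expR (- n.+2%:R)
     - (n.+2%:R)^-1 `^ x * expR (- (n.+2%:R)^-1)) : R) @[n --> \oo] --> (0 : R).
Proof.
move=> x0; rewrite -[in X in _ --> X](subrr (0 : R)); apply: cvgB.
  (* A single Taylor term of the exponential suffices: [t ^ (x + 1) <= t ^ (m + 1) <= (m + 1)! * exp
     t] for [t >= 1]. *)
  have [m hm] : exists m : nat, x + 1 <= m.+1%:R.
    by exists (Num.truncn (x + 1)); apply/ltW/truncnS_gt.
  have c : (m.+1`!%:R * n.+2%:R^-1 : R) @[n --> \oo] --> (0 : R).
    rewrite -[in X in _ --> X](mulr0 m.+1`!%:R); apply: cvgMl_tmp.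
    exact: cvg_natinv0.
  apply: (squeeze_cvgr _ (cvg_cst 0) c).
  apply: nearW => n; rewrite mulr_ge0 ?powR_ge0 ?expR_ge0//=.
  have t0 : 0 < n.+2%:R :> R by [].
  move: (n.+2%:R : R) t0 (ler1n R n.+2) => t t0 t1.
  rewrite expRN ler_pdivrMr ?expR_gt0//.
  have h1 := expR_ge1Dxn m (ltW t0).
  have h2 : t `^ (x + 1) <= t ^+ m.+1.
    by rewrite -powR_mulrn ?(ltW t0)// ler_powR.
  have h3 : t `^ (x + 1) = t `^ x * t.
    by rewrite powRD ?(powRr1 (ltW t0))// (gt_eqF t0) implybT.
  rewrite mulrAC ler_pdivlMr// -h3; apply: (le_trans h2).
  by rewrite mulrC -ler_pdivrMr// (le_trans _ h1)// lerDr.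
have c := cvg_natpow0 2 x0.
apply: (squeeze_cvgr _ (cvg_cst 0) c).
apply: nearW => n; rewrite mulr_ge0 ?powR_ge0 ?expR_ge0//=.
rewrite -[leRHS]mulr1; apply: ler_pM; rewrite ?powR_ge0 ?expR_ge0//.
by rewrite powRN -powR_inv1// -powRrM mulN1r powRN.
Qed.

Lemma Gamma_posS x : 0 < x -> Gamma_pos (x + 1) = x * Gamma_pos x.
Proof.
move=> x0.
have h1 : gamma_cut n (x + 1) @[n --> \oo] --> Gamma_pos (x + 1).
  by apply: gamma_cut_cvg; lra.
have h2 : gamma_cut n (x + 1) @[n --> \oo] --> x * Gamma_pos x - 0.
  under eq_cvg do rewrite gamma_cut_rec.
  apply: cvgB; last exact: powexp_cvg0.
  by apply: cvgMl_tmp; exact: gamma_cut_cvg.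
by rewrite (cvg_unique _ h1 h2) // subr0.
Qed.

Lemma Gamma_pos_ge0 x : 0 <= Gamma_pos x.
Proof. by apply: Rintegral_ge0 => t _; exact: gamma_fun_ge0. Qed.

(* Logarithmic convexity, integrated from [u `^ h <= 1 + h * (u - 1)] at
   [u = t / x]. *)
Lemma Gamma_pos_logconvex x (h : R) : 0 < x -> 0 <= h <= 1 ->
  Gamma_pos (x + h) <= x `^ h * Gamma_pos x.
Proof.
move=> x0 /andP[h0 h1].
have c1 : gamma_cut n (x + h) @[n --> \oo] --> Gamma_pos (x + h).
  by apply: gamma_cut_cvg; lra.
have c2 : x `^ h * ((1 - h) * gamma_cut n x + h / x * gamma_cut n (x + 1))
    @[n --> \oo] --> x `^ h * ((1 - h) * Gamma_pos x + h / x * Gamma_pos (x + 1)).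
  apply: cvgMl_tmp; apply: cvgD; apply: cvgMl_tmp; apply: gamma_cut_cvg; lra.
have -> : x `^ h * Gamma_pos x =
    x `^ h * ((1 - h) * Gamma_pos x + h / x * Gamma_pos (x + 1)).
  by rewrite Gamma_posS//; field; rewrite gt_eqF.
apply: (ler_cvg_to c1 c2); apply: nearW => n.
have [a0 ab] := cut_bounds n.
pose g t := x `^ h * ((1 - h) * gamma_fun x t + h / x * gamma_fun (x + 1) t).
have cl (c : R) y t : 0 < t -> {for t, continuous (fun t => c * gamma_fun y t)}.
  move=> t0; apply: continuousM; first exact: cst_continuous.
  exact: gamma_fun_continuous.
have cs t : 0 < t -> {for t, continuous
    (fun t => (1 - h) * gamma_fun x t + h / x * gamma_fun (x + 1) t)}.
  by move=> t0; apply: continuousD; exact: cl.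
have cg t : 0 < t -> {for t, continuous g}.
  by move=> t0; apply: continuousM; [exact: cst_continuous|exact: cs].
have ic f := @integrable_cut f _ n.+2%:R a0.
have -> : x `^ h * ((1 - h) * gamma_cut n x + h / x * gamma_cut n (x + 1)) =
    (\int[mu]_(t in `[(n.+2%:R)^-1, n.+2%:R]) g t)%R.
  rewrite /g RintegralZl//; last exact: (ic _ cs).
  rewrite RintegralD//; [|exact: (ic _ (cl _ _))|exact: (ic _ (cl _ _))].
  rewrite !RintegralZl//; exact: (ic _ (@gamma_fun_continuous _)).
apply: le_Rintegral => //.
- exact: (ic _ (@gamma_fun_continuous _)).
- exact: (ic _ cg).
move=> t /=; rewrite in_itv/= => /andP[h' _].
have t0 : 0 < t := lt_le_trans a0 h'.
have tn : t != 0 by rewrite gt_eqF.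
rewrite /g /gamma_fun.
have -> : t `^ (x + h - 1) = t `^ (x - 1) * (x `^ h * (t / x) `^ h).
  rewrite -powRM ?divr_ge0 ?ltW// mulrCA divff ?gt_eqF// mulr1.
  by rewrite -powRD ?tn ?implybT//; congr (_ `^ _); ring.
have -> : t `^ (x + 1 - 1) = t `^ (x - 1) * t.
  rewrite -[X in _ * X](powRr1 (ltW t0)) -powRD ?tn ?implybT//.
  by congr (_ `^ _); ring.
have := @powR_le_linear R (t / x) h (divr_gt0 t0 x0) _; rewrite h0 h1 => /(_ isT).
have e0 : 0 <= t `^ (x - 1) * expR (- t) * x `^ h.
  by rewrite !mulr_ge0 ?powR_ge0 ?expR_ge0.
move=> /(ler_wpM2l e0) hle.
rewrite [leLHS](_ : _ = t `^ (x - 1) * expR (- t) * x `^ h * (t / x) `^ h); last by ring.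
apply: (le_trans hle); rewrite le_eqVlt; apply/orP; left; apply/eqP.
by field; rewrite gt_eqF.
Qed.

Lemma Gamma_pos1 : Gamma_pos (1 : R) = 1.
Proof.
have h1 : gamma_cut n 1 @[n --> \oo] --> Gamma_pos (1 : R).
  by apply: gamma_cut_cvg.
have c1 := cvg_natinv0.
have h2 : gamma_cut n 1 @[n --> \oo] --> (expR (- 0) - 0 : R).
  have E n : gamma_cut n 1 = expR (- n.+2%:R^-1) - expR (- n.+2%:R).
    have [a0 ab] := cut_bounds n.
    have dF t : 0 < t -> is_derive t 1 (fun s : R => - expR (- s)) (gamma_fun 1 t).
      move=> t0.
      have h := @is_deriveN _ _ _ id t 1 1 (is_derive_id t 1).
      have h' := @is_derive1_comp R expR (fun s => - s) t (expR (- t)) (-1)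
        (is_derive_expR (- t)) h.
      apply: (is_derive_eq (is_deriveN h')).
      by rewrite /gamma_fun subrr powRr0 mul1r mulrN1 opprK.
    by rewrite /gamma_cut (ftc_cut a0 ab dF (@gamma_fun_continuous 1)); ring.
  under eq_cvg do rewrite E.
  apply: cvgB.
    by apply: continuous_cvg; [exact: continuous_expR|apply: cvgN].
  have := @cvgn_expR R => /(cvg_comp (fun n => n.+2)); apply.
  exact: (cvg_addnl 2).
by rewrite (cvg_unique _ h1 h2)// oppr0 expR0 addr0.
Qed.

(** A zero at [y] in [(0, 1]] would give [Gamma_pos 1 <= 0] by log-convexity; the functional
    equation covers larger arguments. *)
Lemma Gamma_pos_gt0 x : 0 < x -> 0 < Gamma_pos x.
Proof.
have small (y : R) : 0 < y -> y <= 1 -> 0 < Gamma_pos y.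
  move=> y0 y1; rewrite lt_neqAle Gamma_pos_ge0 andbT eq_sym; apply/eqP => Gy0.
  have hy : 0 <= 1 - y <= 1 by lra.
  have := Gamma_pos_logconvex y0 hy.
  by rewrite (_ : y + (1 - y) = 1) ?Gamma_pos1 ?Gy0 ?mulr0 ?ler10//; ring.
have [m hm] : exists m : nat, x <= m.+1%:R.
  by exists (Num.truncn x); apply/ltW/truncnS_gt.
elim: m x hm => [|m IH] x hm x0; first exact: small.
have [x1|x1] := leP x 1; first exact: small.
rewrite -(subrK 1 x) Gamma_posS ?mulr_gt0 ?subr_gt0//.
by apply: IH; rewrite ?subr_gt0// lerBlDr natr1.
Qed.

End GammaFunction.

(** * The value at one half and the growth of Gamma *)

Section GammaAsymptotics.
Context {R : realType}.
Local Notation mu := (@lebesgue_measure R).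
Implicit Types (x t b : R) (n : nat).

(** The substitution [t = u ^+ 2] turns the integral into twice the Gaussian integral over the
    half-line. *)
Lemma Gamma_pos_half : Gamma_pos (1 / 2 : R) = Num.sqrt pi.
Proof.
pose f := gamma_fun (1 / 2 : R).
pose g (t : R) : R := 2 * gauss_fun t.
have h1 : (\int[mu]_(t in `[(n.+2%:R ^+ 2)^-1%R, (n.+2%:R ^+ 2)%R]) (f t)%:E)%E
    @[n --> \oo] --> (\int[mu]_(t in `]0%R, +oo[) (f t)%:E)%E.
  apply: (@cut_cvg R (fun n => n.+2%:R ^+ 2)) => //.
  - by move=> n; rewrite expr2 ler_peMr// ler1n.
  - by move=> m n mn; rewrite ler_sqr ?nnegrE// ler_nat.
  - exact: measurable_gamma_fun.
  - by move=> t _; exact: gamma_fun_ge0.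
have mg : measurable_fun setT (g : R -> R).
  apply: measurable_funM => //; exact: measurable_gauss_fun.
have h2 : (\int[mu]_(t in `[n.+2%:R^-1%R, n.+2%:R]) (g t)%:E)%E
    @[n --> \oo] --> (\int[mu]_(t in `]0%R, +oo[) (g t)%:E)%E.
  apply: (@cut_cvg R (fun n => n.+2%:R)) => //.
  - by move=> m n mn; rewrite ler_nat.
  - by move=> t _; rewrite mulr_ge0// gauss_fun_ge0.
have E n : (\int[mu]_(t in `[(n.+2%:R ^+ 2)^-1%R, (n.+2%:R ^+ 2)%R]) (f t)%:E =
    \int[mu]_(t in `[n.+2%:R^-1%R, n.+2%:R]) (g t)%:E)%E.
  have [a0 ab] := @cut_bounds R n; rewrite -exprVn.
  pose F (u : R) : R := u ^+ 2.
  have dF (u : R) : is_derive u (1 : R) F (2 * u).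
    have h := is_deriveM (is_derive_id u (1 : R)) (is_derive_id u (1 : R)).
    rewrite (_ : F = (fun v => v * v)); last by apply: funext => v; rewrite /F expr2.
    apply: (is_derive_eq h); rewrite /GRing.scale /=; ring.
  have F'E : (F^`() = (fun u => 2 * u))%classic.
    by apply: funext => u; rewrite derive1E; have [_ ->] := dF u.
  have cF' : continuous (fun u : R => 2 * u).
    exact: mulrl_continuous.
  have cF : continuous F.
    move=> u; apply: differentiable_continuous; apply/derivable1_diffP.
    by have [] := dF u.
  rewrite (@integration_by_substitution_increasing R F f _ _ (ltW ab)) ?F'E.
  - apply: eq_integral => u; rewrite inE/= in_itv/= => /andP[hu _].
    have u0 : 0 < u := lt_le_trans a0 hu; congr EFin.
    rewrite -[LHS]/(gamma_fun (1 / 2) (u ^+ 2) * (2 * u)) /g /gauss_fun /gamma_fun.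
    rewrite (_ : 1 / 2 - 1 = - 2^-1 :> R); last by field.
    rewrite powRN powR12_sqrt ?sqr_ge0// sqrtr_sqr gtr0_norm//.
    by field; rewrite gt_eqF.
  - move=> u v; rewrite !in_itv/= => /andP[hu _] /andP[hv _] uv.
    by rewrite /F ltr_sqr ?nnegrE ?(le_trans (ltW a0)).
  - by move=> u _; exact: cF'.
  - by apply: cvgP; apply: cvg_at_right_filter; exact: cF'.
  - by apply: cvgP; apply: cvg_at_left_filter; exact: cF'.
  - split.
    + by move=> u _; have [] := dF u.
    + by apply: cvg_at_right_filter; exact: cF.
    + by apply: cvg_at_left_filter; exact: cF.
  - apply: within_cut; first by rewrite /F exprn_gt0.
    exact: gamma_fun_continuous.
have h3 : (\int[mu]_(t in `]0%R, +oo[) (f t)%:E = \int[mu]_(t in `]0%R, +oo[) (g t)%:E)%E.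
  have h1' : (\int[mu]_(t in `[n.+2%:R^-1%R, n.+2%:R]) (g t)%:E)%E
      @[n --> \oo] --> (\int[mu]_(t in `]0%R, +oo[) (f t)%:E)%E.
    by under eq_cvg do rewrite -E; exact: h1.
  have e1 := cvg_lim (@ereal_hausdorff R) h1'.
  have e2 := cvg_lim (@ereal_hausdorff R) h2.
  by rewrite -e1 -e2.
rewrite /Gamma_pos /Rintegral -/f.
rewrite -[X in fine X]/(\int[mu]_(t in `]0%R, +oo[) (f t)%:E)%E h3.
rewrite integral_itv_obnd_cbnd; last first.
  by apply/measurable_EFinP; exact: measurable_funTS.
under eq_integral do rewrite /g EFinM.
rewrite ge0_integralZl_EFin//=.
- by rewrite integral0y_gauss -EFinM/= mulrCA divff// mulr1.
- by move=> t _; rewrite lee_fin gauss_fun_ge0.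
- by apply/measurable_EFinP/measurable_funTS; exact: measurable_gauss_fun.
Qed.

Lemma Gamma_pos_prod x n : 0 < x ->
  Gamma_pos (x + n%:R) = Gamma_pos x * \prod_(j < n) (x + j%:R).
Proof.
move=> x0; elim: n => [|n IH]; first by rewrite big_ord0 addr0 mulr1.
rewrite big_ord_recr /= mulrA -IH -natr1 addrA Gamma_posS; last first.
  by rewrite ltr_pwDl.
by rewrite mulrC.
Qed.

Lemma cvg_shift_inv0 x : 0 < x -> ((x + n%:R)^-1 : R) @[n --> \oo] --> (0 : R).
Proof.
move=> x0; apply/cvgrPdist_le => e e0; near=> n.
have h : 0 < x + n%:R by rewrite ltr_pwDl.
rewrite sub0r normrN gtr0_norm ?invr_gt0// invf_ple ?posrE//.
apply: (@le_trans _ _ n%:R); last by rewrite lerDr ltW.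
by near: n; exact: nbhs_infty_ger.
Unshelve. all: by end_near. Qed.

Definition gamma_quot x (h : R) n : R :=
  Gamma_pos (x + n%:R + h) / (Gamma_pos (x + n%:R) * (x + n%:R) `^ h).

(** Wendel's argument: log-convexity at [y = x + n] bounds the quotient by 1. Applied from [y + h]
    to [y + 1], it bounds it below by [(y / (y + h)) ^ (1 - h)], hence by [y / (y + h)]. *)
Lemma gamma_quot_cvg x (h : R) : 0 < x -> 0 <= h <= 1 ->
  gamma_quot x h n @[n --> \oo] --> (1 : R).
Proof.
move=> x0 hh.
have c : (1 - h * (x + h + n%:R)^-1 : R) @[n --> \oo] --> (1 : R).
  rewrite -[in X in _ --> X](subr0 1) -[in X in _ --> X](mulr0 h).
  apply: cvgB; first exact: cvg_cst.
  by apply: cvgMl_tmp; apply: cvg_shift_inv0; lra.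
apply: (@squeeze_cvgr _ _ _ _ _ (fun=> 1) _ _ _ c); last exact: cvg_cst.
apply: nearW => n.
rewrite /gamma_quot (addrAC x h); set y := x + n%:R.
have y0 : 0 < y by rewrite /y ltr_pwDl.
have g0 := Gamma_pos_gt0 y0.
have p0 : 0 < y `^ h by rewrite powR_gt0.
apply/andP; split; last first.
  by rewrite ler_pdivrMr ?mulr_gt0// mul1r mulrC Gamma_pos_logconvex.
have yh0 : 0 < y + h by lra.
have h1 : y * Gamma_pos y <= (y + h) `^ (1 - h) * Gamma_pos (y + h).
  rewrite -Gamma_posS// (_ : y + 1 = y + h + (1 - h)); last by ring.
  by apply: Gamma_pos_logconvex => //; lra.
have -> : 1 - h * (y + h)^-1 = y / (y + h) by field; lra.
rewrite ler_pdivlMr ?mulr_gt0//.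
have q0 : 0 < (y + h) `^ (1 - h) by rewrite powR_gt0.
have u1 : y / (y + h) <= (y / (y + h)) `^ (1 - h).
  apply: ger1_powR; last by lra.
  by rewrite divr_gt0//= ler_pdivrMr// mul1r; lra.
have e1 : (y / (y + h)) `^ (1 - h) = y / y `^ h / (y + h) `^ (1 - h).
  rewrite powRM ?invr_ge0 ?ltW//; congr (_ * _).
    by rewrite powRB ?(gt_eqF y0) ?implybT// powRr1// ltW.
  by rewrite -[(y + h)^-1](powR_inv1 (ltW yh0)) -powRrM mulN1r powRN.
apply: (@le_trans _ _ ((y / y `^ h / (y + h) `^ (1 - h)) * (Gamma_pos y * y `^ h))).
  by rewrite ler_wpM2r ?mulr_ge0 ?(ltW g0) ?(ltW p0)// -e1.
have -> : y / y `^ h / (y + h) `^ (1 - h) * (Gamma_pos y * y `^ h) =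
    (y * Gamma_pos y) / (y + h) `^ (1 - h) by field; rewrite !gt_eqF.
by rewrite ler_pdivrMr// [leRHS]mulrC.
Qed.

End GammaAsymptotics.

(** * The limit of the ratio in terms of Gamma *)

Section RatioLimitGamma.
Context {R : realType}.
Implicit Types (x t b : R) (n : nat).

Lemma gamma_quot_gt0 x (h : R) n : 0 < x -> 0 <= h -> 0 < gamma_quot x h n.
Proof.
move=> x0 h0; have y0 : 0 < x + n%:R by rewrite ltr_pwDl.
by rewrite /gamma_quot divr_gt0 ?mulr_gt0 ?Gamma_pos_gt0 ?powR_gt0// ltr_pwDl.
Qed.

Lemma prod_shift_gt0 x n : 0 < x -> 0 < \prod_(j < n) (x + j%:R).
Proof. by move=> x0; apply: prodr_gt0 => j _; rewrite ltr_pwDl. Qed.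

Lemma sib_gamma b k : 0 < b < 1 ->
  sib b k = (Gamma_pos (1 - b) * gamma_quot (1 - b) b k * (1 - b + k%:R) `^ b)^-1.
Proof.
move=> /andP[b0 b1]; have x0 : 0 < 1 - b by lra.
have y0 : 0 < 1 - b + k%:R by rewrite ltr_pwDl.
have pw := powR_gt0 b y0.
have g0 := Gamma_pos_gt0 x0.
have p0 := prod_shift_gt0 k x0.
have p1 := prod_shift_gt0 k (@ltr01 R).
rewrite /gamma_quot (_ : 1 - b + k%:R + b = 1 + k%:R); last by ring.
rewrite !Gamma_pos_prod// Gamma_pos1.
transitivity (\prod_(j < k) (1 - b + j%:R) / \prod_(j < k) (1 + j%:R)).
  rewrite -prodf_div; apply: eq_bigr => j _; rewrite -natr1.
  by have h : 0 <= j%:R :> R by []; field; lra.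
move: pw g0 p0 p1; move: (_ `^ _) (Gamma_pos _) (\prod_(_ < _) _) (\prod_(_ < _) _).
by move=> A B C D *; field; rewrite !gt_eqF.
Qed.

(** The factors of odd denominator in [sib (2 * b) (2 * k)]; those of even denominator form
    [sib b k]. This splitting does the work of Legendre's duplication formula. *)
Definition sib_odd b k : R := \prod_(j < k) ((1 / 2 - b + j%:R) / (1 / 2 + j%:R)).

Lemma sib_double b k : sib (2 * b) (2 * k) = sib b k * sib_odd b k.
Proof.
elim: k => [|k IH]; first by rewrite muln0 /sib_odd !sib0 big_ord0 mulr1.
rewrite mulnS add2n !sibS IH /sib_odd big_ord_recr /=.
rewrite -!natr1 natrM; have : 0 <= k%:R :> R by [].
by move: (k%:R : R) => y y0; field; lra.
Qed.

(** The factor of index 0 has the negative numerator [1 / 2 - b]; it is set apart so that Gamma is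
    only taken at positive arguments. *)
Lemma sib_odd_gamma b m : 1 / 2 < b < 1 ->
  sib_odd b m.+1 = (1 / 2 - b) * Num.sqrt pi /
    (Gamma_pos (3 / 2 - b) * gamma_quot (3 / 2 - b) b m * (3 / 2 - b + m%:R) `^ b).
Proof.
move=> /andP[b0 b1]; have x0 : 0 < 3 / 2 - b by lra.
have y0 : 0 < 3 / 2 - b + m%:R by rewrite ltr_pwDl.
have h0 : 0 < 1 / 2 :> R by lra.
have pw := powR_gt0 b y0.
have g0 := Gamma_pos_gt0 x0.
have g1 := Gamma_pos_gt0 h0; rewrite Gamma_pos_half in g1.
have p0 := prod_shift_gt0 m x0.
have p1 := prod_shift_gt0 m.+1 h0.
rewrite /gamma_quot (_ : 3 / 2 - b + m%:R + b = 1 / 2 + m.+1%:R); last first.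
  by rewrite -natr1; field.
rewrite !Gamma_pos_prod// Gamma_pos_half.
transitivity ((1 / 2 - b) * \prod_(j < m) (3 / 2 - b + j%:R)
    / \prod_(j < m.+1) (1 / 2 + j%:R)).
  rewrite /sib_odd prodf_div; congr (_ / _); rewrite big_ord_recl addr0.
  by congr (_ * _); apply: eq_bigr => j _; rewrite lift0 -(natr1 j); field.
move: pw g0 g1 p0 p1.
move: (_ `^ _) (Gamma_pos _) (Num.sqrt _) (\prod_(_ < _) _) (\prod_(_ < _) _).
by move=> A B C D E *; field; rewrite !gt_eqF.
Qed.

Lemma cvg_nat_oo (f : nat -> nat) : (forall n, (n <= f n)%N) ->
  f n @[n --> \oo] --> \oo.
Proof.
by move=> hf A [N _ NA]; exists N => // m /= Nm; apply: NA => /=; apply: leq_trans (hf m).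
Qed.

Lemma ratio_lim_Gamma b : 1 / 2 < b < 1 ->
  ratio_lim b = (b - 1 / 2) * Num.sqrt pi * Gamma_pos (1 - b)
    / Gamma_pos (3 / 2 - b) * 4 `^ b.
Proof.
move=> /[dup] hb /andP[b0 b1].
have x0 : 0 < 1 - b by lra.
have z0 : 0 < 3 / 2 - b by lra.
have hb0 : 0 <= b by lra.
have hb1 : 0 < b < 1 by lra.
have hb2 : 0 <= b <= 1 by lra.
have z1 : 0 < 2 - b by lra.
have g0 := Gamma_pos_gt0 x0.
have g1 := Gamma_pos_gt0 z0.
set c := _ / Gamma_pos _.
pose q1 m : R := 2 + (b - 1) * (2 - b + m%:R)^-1.
pose q2 m : R := 2 + b * (3 / 2 - b + m%:R)^-1.
pose r1 n : R := gamma_quot (1 - b) b n.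
pose r2 n : R := gamma_quot (3 / 2 - b) b n.
have E m : sib_ratio b (2 * m.+1) =
    c * (r1 (2 * m.+1)%N ^+ 2 / (r1 m.+1 * r2 m)) * (q1 m * q2 m) `^ b.
  rewrite /sib_ratio sib_double sib_odd_gamma// !(@sib_gamma b)//.
  have y1 : 0 < 1 - b + (2 * m.+1)%:R by rewrite ltr_pwDl.
  have y2 : 0 < 1 - b + m.+1%:R by rewrite ltr_pwDl.
  have y3 : 0 < 3 / 2 - b + m%:R by rewrite ltr_pwDl.
  have -> : q1 m * q2 m = (1 - b + (2 * m.+1)%:R) / (1 - b + m.+1%:R) *
      ((1 - b + (2 * m.+1)%:R) / (3 / 2 - b + m%:R)).
    move: y1 y2 y3; rewrite /q1 /q2 natrM -(natr1 m).
    by move: (m%:R : R) => y h1 h2 h3; field; lra.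
  have pI (u : R) : 0 < u -> u^-1 `^ b = (u `^ b)^-1.
    by move=> u0; rewrite -(powR_inv1 (ltW u0)) -powRrM mulN1r powRN.
  rewrite !powRM ?divr_ge0 ?invr_ge0 ?(ltW y1) ?(ltW y2) ?(ltW y3)// !pI//.
  rewrite -/(r1 _) -/(r1 _) -/(r2 _) /c.
  have := powR_gt0 b y1; have := powR_gt0 b y2; have := powR_gt0 b y3.
  have := @gamma_quot_gt0 (1 - b) b (2 * m.+1) x0; rewrite -/(r1 _).
  have := @gamma_quot_gt0 (1 - b) b m.+1 x0; rewrite -/(r1 _).
  have := @gamma_quot_gt0 (3 / 2 - b) b m z0; rewrite -/(r2 _).
  move=> /(_ hb0) + /(_ hb0) + /(_ hb0); move: g0 g1.
  move: (_ `^ _) (_ `^ _) (_ `^ _) (r1 _) (r1 _) (r2 _) (Num.sqrt _).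
  move: (Gamma_pos _) (Gamma_pos _) => *; field; rewrite !gt_eqF//; lra.
(* The whole sequence converges, so the even indices determine the limit. *)
have h1 : sib_ratio b (2 * m.+1) @[m --> \oo] --> ratio_lim b.
  have := ratio_cvg (b := b); rewrite (ltW b0) b1 => /(_ isT) h.
  have -> : (fun m => sib_ratio b (2 * m.+1)) =
      (fun k => sib_ratio b k.+1) \o (fun m => (2 * m).+1).
    by apply: funext => m /=; congr sib_ratio; lia.
  by apply: cvg_comp h; apply: cvg_nat_oo => n; lia.
have c1 : r1 n @[n --> \oo] --> (1 : R) by apply: gamma_quot_cvg.
have c2 : r2 n @[n --> \oo] --> (1 : R) by apply: gamma_quot_cvg.
have c1a : r1 n.+1 @[n --> \oo] --> (1 : R).
  by apply: (cvg_comp _ _ (@cvg_nat_oo S _) c1).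
have c1b : r1 (2 * n.+1)%N @[n --> \oo] --> (1 : R).
  apply: (cvg_comp _ _ (@cvg_nat_oo (fun n => 2 * n.+1)%N _) c1) => n; lia.
have cq1 : q1 n @[n --> \oo] --> (2 : R).
  rewrite -[in X in _ --> X](addr0 2) -[in X in _ --> X](mulr0 (b - 1)).
  apply: cvgD; first exact: cvg_cst.
  by apply: cvgMl_tmp; exact: cvg_shift_inv0.
have cq2 : q2 n @[n --> \oo] --> (2 : R).
  rewrite -[in X in _ --> X](addr0 2) -[in X in _ --> X](mulr0 b).
  apply: cvgD; first exact: cvg_cst.
  by apply: cvgMl_tmp; exact: cvg_shift_inv0.
have h2 : sib_ratio b (2 * m.+1) @[m --> \oo] -->
    c * (1 * 1 / (1 * 1)) * (2 * 2) `^ b.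
  under eq_cvg do rewrite E expr2.
  apply: cvgM.
    apply: cvgMl_tmp; apply: cvgM; first exact: cvgM.
    by apply: cvgV; [rewrite mulr1 oner_eq0|exact: cvgM].
  apply: (@continuous_cvg _ _ _ _ _ (fun n => q1 n * q2 n) (fun t : R => t `^ b)).
    by apply: powR_continuous; rewrite mulr_gt0.
  exact: cvgM.
rewrite (cvg_unique _ h1 h2)// !mulr1 invr1 mulr1.
by rewrite (_ : 2 * 2 = 4 :> R)//; ring.
Qed.

Lemma Gamma_half_sub b : 1 / 2 < b < 1 ->
  Gamma (1 / 2 - b) = Gamma_pos (3 / 2 - b) / (1 / 2 - b).
Proof.
move=> /andP[b0 b1]; rewrite /Gamma ifF; last by apply/negbTE; rewrite -leNgt; lra.
have -> : Num.truncn (- (1 / 2 - b)) = 0%N.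
  by apply/eqP; rewrite truncn_eq; lra.
by rewrite big_ord1 addr0 (_ : 1 / 2 - b + 1%:R = 3 / 2 - b)//; field.
Qed.

Lemma Gamma_equation b : 1 / 2 < b < 1 ->
  (4 `^ b * Num.sqrt pi)^-1 * (Gamma (1 / 2 - b) / Gamma (1 - b)) =
  - (ratio_lim b)^-1.
Proof.
move=> /[dup] hb /andP[b0 b1]; rewrite Gamma_half_sub// ratio_lim_Gamma//.
rewrite /Gamma ifT; last by lra.
have g0 : 0 < Gamma_pos (1 - b) by apply: Gamma_pos_gt0; lra.
have g1 : 0 < Gamma_pos (3 / 2 - b) by apply: Gamma_pos_gt0; lra.
have s0 : 0 < Num.sqrt pi :> R by rewrite sqrtr_gt0 pi_gt0.
have p0 : 0 < 4 `^ b by rewrite powR_gt0.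
have e1 : b * 2 - 1 != 0 by lra.
have e2 : 1 + - b * 2 != 0 by lra.
move: g0 g1 s0 p0; move: (Gamma_pos _) (Gamma_pos _) (Num.sqrt _) (_ `^ _) => A B C D *.
by field; rewrite e1 e2 !gt_eqF.
Qed.

End RatioLimitGamma.

(** * Tails of LIS and convergence *)

Section Tails.
Context {R : realType} (p : R) (hp0 : 0 < p) (hp1 : p < 1).

Lemma lsum_ge0 n phi : (forall a, 0 <= phi a) -> 0 <= lsum p n phi.
Proof.
by move=> h; apply: sumr_ge0 => t _; apply: mulr_ge0; rewrite ?weight_ge0.
Qed.

Lemma gw_ge_sqr m : 1 <= 6 * m.+1%:R ^+ 2 * gw p m.
Proof.
have g0 := gw_ge0 hp0 hp1 m.
have hm : (m%:R + 1 / 2) ^+ 3 <= m.+1%:R ^+ 4 :> R.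
  apply: (@le_trans _ _ (m.+1%:R ^+ 3)).
    have hm : 0 <= m%:R :> R by [].
    by rewrite -(natr1 m) lerXn2r ?nnegrE; lra.
  by rewrite [leRHS]exprS ler_peMl ?exprn_ge0// ler1n.
have h := gw_lower hp0 hp1 m.
have h2 : gw p m ^+ 2 * (m%:R + 1 / 2) ^+ 3 <= gw p m ^+ 2 * m.+1%:R ^+ 4.
  by rewrite ler_wpM2l ?sqr_ge0.
suff : 1 ^+ 2 <= (6 * m.+1%:R ^+ 2 * gw p m) ^+ 2.
  have X0 : 0 <= 6 * m.+1%:R ^+ 2 * gw p m.
    by apply: mulr_ge0 => //; apply: mulr_ge0 => //; apply: exprn_ge0.
  by rewrite ler_sqr ?nnegrE ?ler01.
rewrite expr1n (_ : (6 * m.+1%:R ^+ 2 * gw p m) ^+ 2 =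
  36 * (gw p m ^+ 2 * m.+1%:R ^+ 4)); last by ring.
by move: h h2; move: (gw p m ^+ 2 * _) (gw p m ^+ 2 * _) => A B; lra.
Qed.

(** Here the exact exponent matters: summed over about [n] sizes it gives the [1 / 2] in
    [upper_tail]. *)
Lemma gw_ge_powR m j : (j < m.+1 + m)%N ->
  m.+1%:R `^ (- (3 / 2)) <= 16 * gw p j.
Proof.
move=> hj; have g0 := gw_ge0 hp0 hp1 j; set n : R := m.+1%:R.
have n0 : 0 < n by rewrite /n.
suff : (n `^ (- (3 / 2))) ^+ 2 <= (16 * gw p j) ^+ 2.
  by rewrite ler_sqr ?nnegrE ?powR_ge0 ?(mulr_ge0 _ g0).
have -> : (n `^ (- (3 / 2))) ^+ 2 = (n ^+ 3)^-1.
  rewrite -powR_mulrn ?powR_ge0// -powRrM.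
  by rewrite (_ : - (3 / 2) * 2%:R = - 3%:R :> R) ?powR_invn ?ltW//; field.
have hm : (j%:R + 1 / 2) ^+ 3 <= (2 * n) ^+ 3.
  have : j.+1%:R <= (2 * m.+1)%:R :> R by rewrite ler_nat; lia.
  rewrite -(natr1 j) natrM -/n => h; have j0 : 0 <= j%:R :> R by [].
  by rewrite lerXn2r ?nnegrE; lra.
have h := gw_lower hp0 hp1 j.
have h2 : gw p j ^+ 2 * (j%:R + 1 / 2) ^+ 3 <= gw p j ^+ 2 * (2 * n) ^+ 3.
  by rewrite ler_wpM2l ?sqr_ge0.
rewrite -[leLHS]div1r ler_pdivrMr ?exprn_gt0//.
rewrite (_ : (16 * gw p j) ^+ 2 * n ^+ 3 = 32 * (gw p j ^+ 2 * (2 * n) ^+ 3)); last by ring.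
by move: h h2; move: (gw p j ^+ 2 * _) (gw p j ^+ 2 * _) => A B; lra.
Qed.

Lemma expR_half_le (u : R) : 0 <= u <= 1 -> expR (u / 2) <= 1 + u.
Proof.
move=> /andP[u0 u1].
have h : 1 - u / 2 <= expR (- (u / 2)) by exact: expR_ge1Dx.
rewrite expRN in h; have e0 := expR_gt0 (u / 2).
have h2 : (1 - u / 2) * expR (u / 2) <= 1 by rewrite -ler_pdivlMr// div1r.
nra.
Qed.

(** At [x = n ^ a] the base [z] exceeds [1 + c' * n ^ (d - 1)] with [d = 1 - 2 * b * a > 0], so
    [z ^ n] is at least [exp (c' * n ^ d / 2)], which beats the polynomial factor [1 / gw]. *)
Lemma lower_tail (b a : R) : 1 / 2 < b < 1 -> 1 - p < p * ratio_lim b ->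
  0 < a -> 2 * b * a < 1 ->
  exists C, forall m, lsum p m (fun k => (k <= Num.truncn (m.+1%:R `^ a))%N%:R)
    / ntrees p m <= C * m.+1%:R `^ (-1).
Proof.
move: (hp0) (hp1) => q0 q1 hb hc a0 ha.
have /andP[b0 b1] := hb.
pose d := 1 - 2 * b * a.
have d0 : 0 < d by rewrite /d; lra.
have d1 : d <= 1 by rewrite /d gerBl mulr_ge0//; lra.
pose c := p * ratio_lim b - (1 - p).
have c0 : 0 < c by rewrite /c; lra.
pose c' := Num.min 1 (c * (1 - b) ^+ 2).
have hb2 : 0 < (1 - b) ^+ 2 by rewrite exprn_gt0; lra.
have c'0 : 0 < c' by rewrite /c' lt_min ltr01 mulr_gt0.
have c'1 : c' <= 1 by rewrite /c' ge_min lexx.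
(* The Taylor term of order [M + 1] in [n ^ d] is then at least a multiple of [n ^ 3]: two powers
   absorb [1 / gw], one gives the decay. *)
have [M hM] : exists M : nat, 3 <= d * M.+1%:R.
  exists (Num.truncn (3 / d)); rewrite mulrC -ler_pdivrMr//.
  exact/ltW/truncnS_gt.
exists (6 * (M.+1`!%:R / (c' / 2) ^+ M.+1)) => m.
set n : R := m.+1%:R; set x := Num.truncn _.
have n0 : 0 < n by rewrite /n.
have n1 : 1 <= n by rewrite /n ler1n.
have na : 1 <= n `^ a by rewrite -(powRr0 n) ler_powR// ltW.
have x1 : (0 < x)%N by rewrite /x truncn_gt0.
have xn : x%:R <= n `^ a by rewrite /x truncn_le// powR_ge0.
set P := lsum p m _ / ntrees p m.
have P0 : 0 <= P.
  by apply: divr_ge0; [exact: lsum_ge0|exact: ltW (ntrees_gt0 hp0 hp1 m)].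
have := lsum_cdf_le hp0 hp1 x m hb hc; rewrite -/P -/c => hP.
set z := 1 + c * _ in hP.
pose u := c' * n `^ (d - 1).
have u0 : 0 <= u by rewrite mulr_ge0 ?powR_ge0// ltW.
have u1 : u <= 1.
  rewrite /u -[leRHS]mulr1; apply: ler_pM => //; rewrite ?powR_ge0 ?(ltW c'0)//.
  by rewrite -[leRHS](powRr0 n) ler_powR// subr_le0.
have zu : 1 + u <= z.
  rewrite /z lerD2l /u.
  apply: (@le_trans _ _ (c * (1 - b) ^+ 2 * n `^ (d - 1))).
    by rewrite ler_wpM2r ?powR_ge0// /c' ge_min lexx orbT.
  rewrite -mulrA ler_pM2l//.
  have hs : (1 - b) * x%:R `^ (- b) <= sib b x.
    by rewrite -(prednK x1); apply: sib_lower; lra.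
  have x0 : 0 < x%:R :> R by rewrite ltr0n.
  have -> : n `^ (d - 1) = ((n `^ a) `^ (- b)) ^+ 2.
    rewrite -powR_mulrn ?powR_ge0// -!powRrM; congr (_ `^ _).
    by rewrite /d; ring.
  rewrite -exprMn ler_sqr ?nnegrE ?mulr_ge0 ?powR_ge0 ?(ltW (sib_gt0 x b1)) ?subr_ge0 ?(ltW b1)//.
  apply: le_trans hs; apply: ler_wpM2l; first by rewrite subr_ge0 ltW.
  rewrite !powRN lef_pV2 ?posrE ?powR_gt0//.
  by apply: ge0_ler_powR; rewrite ?nnegrE ?powR_ge0//; lra.
have hz : expR (u / 2) ^+ m.+1 <= z ^+ m.+1.
  rewrite lerXn2r ?nnegrE ?expR_ge0//; first by lra.
  by apply: le_trans zu; apply: expR_half_le; rewrite u0.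
have hexp : (c' / 2) ^+ M.+1 / M.+1`!%:R * n ^+ 3 <= z ^+ m.+1.
  apply: le_trans hz; rewrite -expRM_natl -/n.
  have -> : n * (u / 2) = c' / 2 * n `^ d.
    rewrite /u powRB ?(gt_eqF n0) ?implybT// powRr1 ?ltW//.
    by field; rewrite gt_eqF.
  have s0 : 0 <= c' / 2 * n `^ d by rewrite mulr_ge0 ?powR_ge0//; lra.
  have := expR_ge1Dxn M s0; apply: le_trans.
  apply: (@le_trans _ _ ((c' / 2 * n `^ d) ^+ M.+1 / M.+1`!%:R)); last by rewrite lerDr.
  rewrite [(_ * n `^ d) ^+ _]exprMn mulrAC; apply: ler_wpM2r; first by rewrite invr_ge0.
  apply: ler_wpM2l; first by apply: exprn_ge0; lra.
  rewrite -[leRHS]powR_mulrn ?powR_ge0// -powRrM -[leLHS]powR_mulrn ?(ltW n0)//.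
  by rewrite ler_powR.
have h6 := gw_ge_sqr m; rewrite -/n in h6.
have g0 := gw_ge0 hp0 hp1 m.
have cM : 0 < (c' / 2) ^+ M.+1 / M.+1`!%:R :> R.
  by rewrite divr_gt0 ?exprn_gt0 ?ltr0n ?fact_gt0//; lra.
rewrite powR_inv1 ?(ltW n0)//.
have -> : 6 * (M.+1`!%:R / (c' / 2) ^+ M.+1) * n^-1 =
    6 * n ^+ 2 / ((c' / 2) ^+ M.+1 / M.+1`!%:R * n ^+ 3).
  have X0 : 0 < (c' / 2) ^+ M.+1 by rewrite exprn_gt0//; lra.
  have f0 : 0 < M.+1`!%:R :> R by rewrite ltr0n fact_gt0.
  move: X0 f0; move: ((c' / 2) ^+ _) (M.+1`!%:R : R) => X Y X0 Y0.
  by field; rewrite !gt_eqF.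
move: cM hexp; move: ((c' / 2) ^+ M.+1 / _) => K K0 hK.
rewrite ler_pdivlMr ?mulr_gt0 ?exprn_gt0//.
apply: (@le_trans _ _ (P * z ^+ m.+1)); first by rewrite ler_wpM2l.
have z0 : 0 <= z ^+ m.+1 by rewrite exprn_ge0//; lra.
have hPz : 0 <= P * z ^+ m.+1 by rewrite mulr_ge0.
apply: (@le_trans _ _ (P * z ^+ m.+1 * (6 * n ^+ 2 * gw p m))).
  by rewrite ler_peMr.
rewrite (_ : P * _ * _ = 6 * n ^+ 2 * (P * gw p m * z ^+ m.+1)); last by ring.
by rewrite ler_piMr// mulr_ge0 ?exprn_ge0// ltW.
Qed.

(** By monotonicity in the size, the tail probability at [m] bounds from below those at all [j] in
    [[m, 2 * m]]. Their Galton-Watson weights total at least a multiple of [n ^ (- 1 / 2)], while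
    the full tail is at most [C * n ^ (- a * b)]. *)
Lemma upper_tail (b a : R) : 1 / 2 < b < 1 -> p * ratio_lim b < 1 - p -> 0 < a ->
  exists C, forall m, lsum p m (fun k => (Num.truncn (m.+1%:R `^ a) < k)%N%:R)
    / ntrees p m <= C * m.+1%:R `^ (1 / 2 - a * b).
Proof.
move: (hp0) (hp1) => q0 q1 hb hc a0.
have /andP[b0 b1] := hb.
have [C C0 hC] := gsum_tail_le hp0 hp1 hb hc.
exists (16 * C) => m.
set n : R := m.+1%:R; set x := Num.truncn _.
have n0 : 0 < n by rewrite /n.
pose phi k : R := (x < k)%N%:R.
have phi_mono : {homo phi : i j / (i <= j)%N >-> i <= j}.
  by move=> i j ij; rewrite /phi; case: (ltnP x i) => // xi; rewrite (leq_trans xi ij).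
have hx : n `^ a <= x.+1%:R by apply/ltW/truncnS_gt.
rewrite -/phi; set P := lsum p m _ / ntrees p m.
have h1 : P * (n / 16 * n `^ (- (3 / 2))) <= gsum p 1 (m.+1 + m) phi.
  apply: (@le_trans _ _ (\sum_(m <= j < m.+1 + m) P * (n `^ (- (3 / 2)) / 16))).
    rewrite sumr_const_nat addSnnS addKn -mulr_natr -/n.
    by rewrite le_eqVlt; apply/orP; left; apply/eqP; field.
  rewrite /gsum -(big_mkord xpredT (fun j => 1 ^+ j.+1 / (2 * 4 ^+ j) * lsum p j phi)).
  rewrite [leRHS](@big_cat_nat _ _ _ m)//=; last by lia.
  apply: ler_wpDl.
    apply: sumr_ge0 => j _; apply: mulr_ge0; first exact: gsum_coef_ge0.
    exact: lsum_ge0.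
  rewrite big_nat [leRHS]big_nat; apply: ler_sum => j /andP[mj jm].
  have nt := ntrees_gt0 hp0 hp1 j.
  have -> : 1 ^+ j.+1 / (2 * 4 ^+ j) * lsum p j phi = lsum p j phi / ntrees p j * gw p j.
    by rewrite expr1n /gw; field; rewrite expf_neq0//= gt_eqF.
  apply: ler_pM.
  - by apply: divr_ge0; [exact: lsum_ge0|exact: ltW (ntrees_gt0 hp0 hp1 m)].
  - by rewrite mulr_ge0 ?powR_ge0// invr_ge0.
  - exact: lsum_ratio_mono.
  - by rewrite ler_pdivrMr// [leRHS]mulrC; apply: gw_ge_powR.
have h2 : gsum p 1 (m.+1 + m) phi <= C * n `^ (- (a * b)).
  apply: (le_trans (hC _ _)); rewrite ler_pM2l//.
  apply: (@le_trans _ _ (x.+1%:R `^ (- b))); first by apply: sib_upper; lra.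
  rewrite -mulrN powRrM.
  rewrite !(powRN _ b) lef_pV2 ?posrE ?powR_gt0//.
  by apply: ge0_ler_powR; rewrite ?nnegrE ?powR_ge0//; lra.
have e1 : n / 16 * n `^ (- (3 / 2)) = n `^ (- (1 / 2)) / 16.
  rewrite mulrAC; congr (_ / _).
  rewrite -[X in X * _](powRr1 (ltW n0)) -powRD ?(gt_eqF n0) ?implybT//.
  by congr (_ `^ _); field.
rewrite e1 in h1.
have p0 : 0 < n `^ (- (1 / 2)) / 16 by rewrite divr_gt0 ?powR_gt0.
rewrite -(ler_pM2r p0); apply: (le_trans h1); apply: (le_trans h2).
have -> : 16 * C * n `^ (1 / 2 - a * b) * (n `^ (- (1 / 2)) / 16) =
    C * (n `^ (1 / 2 - a * b) * n `^ (- (1 / 2))) by field.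
rewrite -powRD ?(gt_eqF n0) ?implybT//.
by rewrite (_ : 1 / 2 - a * b + - (1 / 2) = - (a * b))//; ring.
Qed.

End Tails.

(** * Convergence in probability and the equation for the exponent *)

Section Convergence.
Context {R : realType} (p : R) (hp0 : 0 < p) (hp1 : p < 1).

Lemma Prob_T_le m (E : pred stree) (phi : nat -> R) :
  (forall t, (E t)%:R <= phi (lis t)) ->
  Prob_T p m.+1 E <= lsum p m phi / ntrees p m.
Proof.
move=> h; rewrite /Prob_T.
have -> : \sum_(t <- all_trees m.+1) weight p t = ntrees p m.
  by apply: eq_bigr => t _; rewrite mulr1.
rewrite ler_wpM2r ?invr_ge0 ?(ltW (ntrees_gt0 hp0 hp1 m))//.
rewrite big_mkcond; apply: ler_sum => t _.
have := ler_wpM2l (weight_ge0 hp0 hp1 t) (h t).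
by case: (E t) => /=; rewrite ?mulr1 ?mulr0.
Qed.

Lemma Prob_T_ge0 n (E : pred stree) : 0 <= Prob_T p n E.
Proof. by apply: divr_ge0; apply: sumr_ge0 => t _; exact: weight_ge0. Qed.

(** The lower exponent is raised to at least [al / 2] because [lower_tail] asks for a positive
    one. *)
Lemma deviation_imply m (al eps : R) t : 0 < eps -> (0 < m)%N ->
  eps < `| ln (LIS t)%:R / ln m.+1%:R - al | ->
  (lis t <= Num.truncn (m.+1%:R `^ Num.max (al - eps) (al / 2))%R)%N
  || (Num.truncn (m.+1%:R `^ (al + eps))%R < lis t)%N.
Proof.
move=> e0 m0 h.
set n : R := m.+1%:R; have n1 : 1 < n by rewrite /n ltr1n.
have n0 : 0 < n by apply: lt_trans n1.
have l0 : 0 < ln n by apply: ln_gt0.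
rewrite LIS_lis in h; set L := lis t in h *.
have L0 : 0 < L%:R :> R by rewrite ltr0n lis_gt0.
have [hL|hL] := leP (ln L%:R / ln n) al.
  have h1 : ln L%:R / ln n < al - eps.
    by move: h; rewrite ler0_norm; lra.
  apply/orP; left; rewrite truncn_ge_nat ?powR_ge0//.
  apply: (@le_trans _ _ (n `^ (al - eps))); last first.
    by rewrite ler_powR ?(ltW n1)// le_max lexx.
  rewrite -ler_ln ?posrE ?powR_gt0// ln_powR -ler_pdivrMr//.
  exact: ltW.
have h1 : al + eps < ln L%:R / ln n.
  by move: h; rewrite gtr0_norm; lra.
apply/orP; right; rewrite truncn_lt_nat ?powR_ge0//.
by rewrite -ltr_ln ?posrE ?powR_gt0// ln_powR -ltr_pdivlMr.
Qed.

Lemma Prob_T_deviation_cvg (b eps : R) : 1 / 2 < b < 1 ->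
  p * ratio_lim b = 1 - p -> 0 < eps ->
  (Prob_T p n (fun t => eps < `| ln (LIS t)%:R / ln n%:R - 1 / (2 * b) |))
    @[n --> \oo] --> (0 : R).
Proof.
move: (hp0) (hp1) => q0 q1 /andP[b0 b1] hK e0.
set al := 1 / (2 * b).
have al0 : 0 < al by rewrite divr_gt0//; lra.
have alb : 2 * b * al = 1 by rewrite /al; field; lra.
pose a1 := Num.max (al - eps) (al / 2); pose a2 := al + eps.
have a1_gt0 : 0 < a1 by rewrite /a1 lt_max; apply/orP; right; lra.
have a1_lt : a1 < al by rewrite /a1 gt_max; apply/andP; split; lra.
have a2_gt : al < a2 by rewrite /a2; lra.
have a2_gt0 : 0 < a2 by lra.
have bb0 : 0 < 2 * b by lra.
have hba1 : 2 * b * a1 < 1 by rewrite -[ltRHS]alb ltr_pM2l.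
have hba2 : 1 < 2 * b * a2 by rewrite -[ltLHS]alb ltr_pM2l.
(* Both tail bounds need strict inequalities, so the critical [b] is moved slightly: up for the
   lower tail and down for the upper tail, halfway to the last value for which the exponents still
   give decay. *)
have [b1' hb1' ha1] : exists2 b', b < b' < 1 & 2 * b' * a1 < 1.
  pose c := Num.min 1 (1 / (2 * a1)).
  have bc : b < c.
    rewrite /c lt_min b1/= ltr_pdivlMr; last by lra.
    lra.
  exists ((b + c) / 2).
    have : c <= 1 by rewrite /c ge_min lexx.
    lra.
  have hc : c * (2 * a1) <= 1.
    by rewrite -ler_pdivlMr ?mulr_gt0// /c ge_min lexx orbT.
  nra.
have [b2' hb2' ha2] : exists2 b', 1 / 2 < b' < b & 1 / 2 < a2 * b'.
  pose c := Num.max (1 / 2) (1 / (2 * a2)).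
  have cb : c < b.
    rewrite /c gt_max b0/= ltr_pdivrMr; last by lra.
    lra.
  exists ((b + c) / 2).
    have : 1 / 2 <= c by rewrite /c le_max lexx.
    lra.
  have hc : 1 <= c * (2 * a2).
    by rewrite -ler_pdivrMr ?mulr_gt0// /c le_max lexx orbT.
  nra.
have K1 : 1 - p < p * ratio_lim b1'.
  by rewrite -hK ltr_pM2l//; apply: ratio_lim_lt; lra.
have K2 : p * ratio_lim b2' < 1 - p.
  by rewrite -hK ltr_pM2l//; apply: ratio_lim_lt; lra.
have h1' : 1 / 2 < b1' < 1 by lra.
have h2' : 1 / 2 < b2' < 1 by lra.
have [C1 hC1] := lower_tail hp0 hp1 h1' K1 a1_gt0 ha1.
have [C2 hC2] := upper_tail hp0 hp1 h2' K2 a2_gt0.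
have c : (C1 * (0 + n)%:R `^ (-1) + C2 * (0 + n)%:R `^ (- (a2 * b2' - 1 / 2)))
    @[n --> \oo] --> C1 * 0 + C2 * 0.
  by apply: cvgD; apply: cvgMl_tmp; apply: cvg_natpow0; rewrite ?subr_gt0.
rewrite !mulr0 addr0 in c.
apply: (@squeeze_cvgr _ _ _ _ (fun=> 0) _ _ _ _ (cvg_cst _) c).
near=> n; rewrite Prob_T_ge0/=.
have n1 : (1 < n)%N by near: n; exact: nbhs_infty_gt.
have : (0 < n.-1)%N by rewrite -ltnS (ltn_predK n1).
rewrite add0n -(ltn_predK n1) /=; move: n.-1 => m m0.
apply: le_trans (lerD (hC1 m) _); last first.
  rewrite opprB; exact: (hC2 m).
rewrite -mulrDl.
pose A k := (k <= Num.truncn (m.+1%:R `^ a1))%N.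
pose B k := (Num.truncn (m.+1%:R `^ a2) < k)%N.
apply: (le_trans (@Prob_T_le m _ (fun k => (A k)%:R + (B k)%:R) _)).
  move=> t; case: ltP => [h|_]; last by rewrite addr_ge0.
  have := deviation_imply e0 m0 h; rewrite -/a1 -/a2 -/(A _) -/(B _).
  by case/orP => ->; rewrite ?lerDl ?lerDr.
rewrite ler_wpM2r ?invr_ge0 ?(ltW (ntrees_gt0 hp0 hp1 m))//.
have := @lsumZD _ p m 1
  (fun k => (k <= Num.truncn (m.+1%:R `^ a1))%N%:R)
  (fun k => (Num.truncn (m.+1%:R `^ a2) < k)%N%:R).
rewrite mul1r => <-; rewrite le_eqVlt; apply/orP; left; apply/eqP.
by apply: lsum_ext => k; rewrite mul1r.
Unshelve. all: by end_near. Qed.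

End Convergence.

Theorem theorem2p2 (R : realType) (p : R) (hp0 : 0 < p) (hp1 : p < 1) :
  let F := fun a : R =>
    (4 `^ (1 / (2 * a)) * Num.sqrt pi)^-1 *
      (Gamma (1 / 2 - 1 / (2 * a)) / Gamma (1 - 1 / (2 * a))) in
  exists alpha : R,
    [/\ 1 / 2 < alpha < 1,
        F alpha = p / (p - 1),
        (forall b : R, 1 / 2 < b < 1 -> F b = p / (p - 1) -> b = alpha) &
        (forall eps : R, 0 < eps ->
           (fun n : nat => Prob_T p n
              (fun t => eps < `| ln (LIS t)%:R / ln n%:R - alpha |)) @ \oo --> 0)].
Proof.
move=> F.
have k0 : 0 < (1 - p) / p by rewrite divr_gt0//; lra.
have [b hb hK] := ratio_lim_surj k0.
have /andP[b0 b1] := hb.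
(* The map [c -> 1 / (2 * c)] is an involution of [(1/2, 1)] exchanging [alpha] and [b]. *)
have dual (c : R) : 1 / 2 < c < 1 -> 1 / 2 < 1 / (2 * c) < 1.
  move=> /andP[c0 c1]; have c2 : 0 < 2 * c by lra.
  by rewrite ltr_pdivlMr// ltr_pdivrMr//; apply/andP; split; lra.
have FE c : 1 / 2 < c < 1 -> F c = - (ratio_lim (1 / (2 * c)))^-1.
  by move=> hc; rewrite /F Gamma_equation// dual.
have invol : 1 / (2 * (1 / (2 * b))) = b by field; lra.
have kE : - ((1 - p) / p)^-1 = p / (p - 1) by field; lra.
exists (1 / (2 * b)); split.
- exact: dual.
- by rewrite FE ?dual// invol hK.
(* Uniqueness comes from the strict monotonicity of [ratio_lim]. *)
- move=> c hc; rewrite FE// -kE => /oppr_inj/invr_inj hc'.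
  have /andP[c0 c1] := dual c hc.
  have cb : 1 / (2 * c) = b.
    have [h|h|//] := ltgtP (1 / (2 * c)) b.
      by have := ratio_lim_lt (ltW c0) h b1; rewrite hc' hK ltxx.
    by have := ratio_lim_lt (ltW b0) h c1; rewrite hc' hK ltxx.
  by rewrite -cb; field; lra.
- move=> eps e0; apply: Prob_T_deviation_cvg => //.
  by rewrite hK mulrC divfK// gt_eqF.
Qed.
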